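(* Let $\mathrm{Ai}$ be the Airy function. For $x\in\mathbb R$, $x<0$, there exists a decomposition $$\mathrm{Ai}(x)=\mathrm{Ai}_0(x)+\mathrm{Ai}_1(x)$$ as a sum of two real analytic functions of $x$ with strong asymptotic expansions (for $u\to+\infty$) $$\mathrm{Ai}_0(-u^{\frac23})\sim\frac{u^{-1/6}}{2\pi^{3/2}}\cos\Big(\frac\pi4-\frac23u\Big)\sum_{n\ \mathrm{even}}(-1)^{n/2}\,\frac{\Gamma(n+\frac56)\Gamma(n+\frac16)}{n!}\Big(\frac34\Big)^nu^{-n},$$ $$\mathrm{Ai}_1(-u^{\frac23})\sim-\frac{u^{-1/6}}{2\pi^{3/2}}\sin\Big(\frac\pi4-\frac23u\Big)\sum_{n\ \mathrm{odd}}(-1)^{\frac{n-1}2}\,\frac{\Gamma(n+\frac56)\Gamma(n+\frac16)}{n!}\Big(\frac34\Big)^nu^{-n}.$$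
   Context: The Airy function is $\mathrm{Ai}(x)=\frac1{2\pi}\int e^{i(\frac{s^3}3+xs)}ds$, the integral being taken over the line $\{t+i\epsilon\mid t\in\mathbb R\}$ for some $\epsilon>0$ (oscillatory integral over $\mathbb R$). For $\alpha>0$ let $G_\alpha$ be the set of functions $h$ of the positive real variable $u$ with $h(u)=1+O(u^{-\alpha})$ for $u\to+\infty$. An expansion $f(u)\sim\sum_{k=1}^\infty t_k(u)$, with $f,t_k$ functions of $u>0$, is a strong asymptotic expansion if for any $\alpha>0$ there exists $n_\alpha$ such that $f\in\big(\sum_{k=1}^nt_k\big)G_\alpha$ for all $n\ge n_\alpha$, i.e. $f=\big(\sum_{k=1}^nt_k\big)h$ with $h\in G_\alpha$, the equality being understood for $u$ sufficiently large. In the expansions above the terms $t_k$ are the successive terms of the series (over $n$ even, $n\geq 0$, resp. $n$ odd, $n\ge1$), multiplied by the common prefactor. *)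

(* Defs.v *)
From Stdlib Require Import Reals Factorial.
From Coquelicot Require Import Coquelicot.
Open Scope R_scope.

Definition Cexp (z : C) : C :=
  (RtoC (exp (Re z)) * (cos (Im z), sin (Im z)))%C.

(* Integral over the line {t + i eps | t in R}, parametrized by t (so ds = dt).
   The library only integrates over real intervals, with values here in C viewed
   as a normed space over R. For eps > 0 the value does not depend on eps. *)
Definition Airy (eps : R) (x : R) : C :=
  (RtoC (/ (2 * PI)) *
   RInt_gen (V := C_R_CompleteNormedModule)
     (fun t : R =>
        let s := (RtoC t + Ci * RtoC eps)%C in
        Cexp (Ci * (s ^ 3 / RtoC 3 + RtoC x * s)))%C
     (Rbar_locally m_infty) (Rbar_locally p_infty))%C.

(* Euler's integral, used only for x > 0. *)
Definition Gamma (x : R) : R :=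
  RInt_gen (fun t : R => Rpower t (x - 1) * exp (- t))
    (at_right 0) (Rbar_locally p_infty).

Definition real_analytic_at (f : R -> R) (x0 : R) : Prop :=
  exists (a : nat -> R) (r : R), 0 < r /\
    forall x : R, Rabs (x - x0) < r -> is_pseries a (x - x0) (f x).

(* Membership of h in the set G_alpha: h(u) = 1 + O(u^-alpha) as u -> +oo. *)
Definition in_G (alpha : R) (h : R -> R) : Prop :=
  exists M : R,
    Rbar_locally p_infty (fun u => Rabs (h u - 1) <= M * Rpower u (- alpha)).

(* The terms are t 1, t 2, ...; the value t 0 is never used. *)
Definition strong_asymptotic_expansion (f : R -> R) (t : nat -> R -> R) : Prop :=
  forall alpha : R, 0 < alpha ->
  exists N : nat, forall n : nat, (N <= n)%nat ->
  exists h : R -> R, in_G alpha h /\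
    Rbar_locally p_infty
      (fun u => f u = sum_n_m (fun k => t k u) 1 n * h u).

Definition airy_coef (n : nat) : R :=
  Gamma (INR n + 5 / 6) * Gamma (INR n + 1 / 6) / INR (fact n) * (3 / 4) ^ n.

(* k-th term (k >= 1) of the expansion of Ai_0: the summand of even index
   n = 2(k-1), multiplied by the prefactor. *)
Definition Ai0_term (k : nat) (u : R) : R :=
  let n := (2 * (k - 1))%nat in
  Rpower u (- (1 / 6)) / (2 * Rpower PI (3 / 2)) * cos (PI / 4 - 2 / 3 * u) *
  ((-1) ^ (n / 2) * airy_coef n * / u ^ n).

(* k-th term (k >= 1) of the expansion of Ai_1: the summand of odd index
   n = 2k-1, multiplied by the prefactor. *)
Definition Ai1_term (k : nat) (u : R) : R :=
  let n := (2 * k - 1)%nat in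
  - (Rpower u (- (1 / 6)) / (2 * Rpower PI (3 / 2))) * sin (PI / 4 - 2 / 3 * u) *
  ((-1) ^ ((n - 1) / 2) * airy_coef n * / u ^ n).

(* Main.v *)
Require Import Defs.
From Stdlib Require Import Reals Lra Lia Factorial.
From Coquelicot Require Import Coquelicot.
Open Scope R_scope.

(** Write the integrand of the Airy function as E(s) = exp(i(s^3/3 + x s)).  It
    is exchanged with its conjugate by s -> - conj s, so the integral over the line
    Im s = eps is twice the real part of the integral over its right half.  Let F(x)
    be the integral of E along the contour that comes up the imaginary axis from
    - i oo to i eps and then follows the line Im s = eps to the right.  The first
    piece is purely imaginary, hence Ai(x) = Re F(x) / PI.  With the phase
    theta(x) = PI/4 - (2/3)(-x)^(3/2), split F = e^(i theta) (A + i B), A and B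
    real; then Ai = (cos theta * A - sin theta * B) / PI, and the two terms are Ai_0
    and Ai_1.  The exact factors cos theta and sin theta are what makes strong
    expansions possible: they account for all the zeros of Ai_0 and Ai_1 at large
    arguments, and ordinary expansions of A and B suffice
    (strong_expansion_intro).

    Expansion.  For x = - v^4 the saddle point of the exponent on the right is v^2.
    The two ends of the straight line through it in the direction e^(i PI/3) bound the
    sectors of decay in which the contour of F ends; on the line itself the cubic part
    of the exponent only oscillates, and the quadratic part makes E decay like a
    Gaussian.  Cauchy's theorem (exp_primitive) moves the contour of F to that line
    (contour_shift); with
    s = v^2 + e^(i PI/3) r / v this gives
      A + i B = (2/v) * int_0^oo exp(i PI/12 - e^(i PI/6) r^2) cos(r^3/(3 v^3)) dr.
    Expanding the cosine by Taylor's formula, with a remainder that is integrated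
    against the Gaussian, leaves the moments of a rotated Gaussian.  Raising
    the degree by 6 multiplies them by a positive rational and by - i
    (rotated_moment_6); so the coefficient of u^-n, u = v^6, is a real number times
    i^n, the even n contribute to A, the odd n to B.

    Coefficients.  Up to a constant factor, both these real numbers and the
    airy_coef n satisfy one first order recursion (moment_coef_airy), so that it is
    enough to compare them at n = 0, that is to know
    (int_0^oo e^(-t^2))^2 = PI/4 and Gamma(1/6) Gamma(5/6) = 2 PI.  These are the
    two cases k = 0 and k = 4 of improper_product.

    Analyticity.  F is an integral of exponentials of linear functions of x against
    rapidly decreasing weights, so its Taylor series can be integrated term by term
    (analytic_integral).  The phase factors solve linear differential equations
    with analytic coefficients, and a power series solution is built by recursion
    and identified by uniqueness (analytic_linear_ode). *)

(** * Improper integrals over the positive half line *)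

Ltac smooth := intros; apply (ex_derive_continuous (V := R_NormedModule)); auto_derive; auto.

(** Lemmas stated for general normed modules leave equations whose type only unfolds to R. *)
Ltac in_reals := match goal with |- @eq _ ?a ?b => change (@eq R a b) end.

(** The side conditions of [field] in this file: powers and factorials. *)
Ltac nonzero := repeat split; try apply INR_fact_neq_0; repeat apply pow_nonzero; lra.

Lemma continuous_ex_RInt (f : R -> R) (a b : R) :
  (forall t, continuous f t) -> ex_RInt f a b.
Proof. intros Hf; apply (ex_RInt_continuous (V := R_CompleteNormedModule)); auto. Qed.

Lemma RInt_primitive (f g : R -> R) (a b : R) :
  (forall t, is_derive f t (g t)) -> (forall t, continuous g t) ->
  RInt g a b = f b - f a.
Proof.
  intros Hf Hg; apply is_RInt_unique.
  apply (is_RInt_derive (V := R_CompleteNormedModule)); auto.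
Qed.

Lemma RInt_diff (f : R -> R) (a b : R) :
  (forall t, continuous f t) -> RInt f a b = RInt f 0 b - RInt f 0 a.
Proof.
  intros cf.
  assert (H : RInt f 0 a + RInt f a b = RInt f 0 b).
  { apply (RInt_Chasles (V := R_CompleteNormedModule)); now apply continuous_ex_RInt. }
  rewrite <- H; symmetry; apply Rplus_minus_l.
Qed.

Lemma RInt_even (f : R -> R) (T : R) :
  (forall t, continuous f t) -> (forall t, f (- t) = f t) -> RInt f 0 (- T) = - RInt f 0 T.
Proof.
  intros cf H.
  assert (E := RInt_comp_lin (V := R_CompleteNormedModule) f (-1) 0 0 T
    (continuous_ex_RInt _ _ _ cf)).
  replace (-1 * 0 + 0) with 0 in E by ring; replace (-1 * T + 0) with (- T) in E by ring.
  rewrite <- E.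
  rewrite (RInt_ext _ (fun t => scal (-1) (f t))).
  - rewrite (RInt_scal (V := R_CompleteNormedModule)).
    + unfold scal; simpl; unfold mult; simpl; in_reals; ring.
    + now apply continuous_ex_RInt.
  - intros t _; f_equal. rewrite <- H; f_equal; ring.
Qed.

Lemma RInt_odd (f : R -> R) (T : R) :
  (forall t, continuous f t) -> (forall t, f (- t) = - f t) -> RInt f 0 (- T) = RInt f 0 T.
Proof.
  intros cf H.
  assert (E := RInt_comp_lin (V := R_CompleteNormedModule) f (-1) 0 0 T
    (continuous_ex_RInt _ _ _ cf)).
  replace (-1 * 0 + 0) with 0 in E by ring; replace (-1 * T + 0) with (- T) in E by ring.
  rewrite <- E.
  apply RInt_ext; intros t _. replace (-1 * t + 0) with (- t) by ring. rewrite H.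
  unfold scal; simpl; unfold mult; simpl; in_reals; ring.
Qed.

Lemma derive_bounded_variation (F g : R -> R) (a b M : R) :
  (forall t, Rmin a b <= t <= Rmax a b -> is_derive F t (g t)) ->
  (forall t, Rmin a b <= t <= Rmax a b -> Rabs (g t) <= M) ->
  Rabs (F b - F a) <= Rabs (b - a) * M.
Proof.
  intros HF Hg.
  destruct (MVT_gen F a b g) as [c [Hc E]].
  - intros x Hx; apply HF; lra.
  - intros x Hx; apply derivable_continuous_pt; exists (g x); apply is_derive_Reals, HF; lra.
  - rewrite E, Rabs_mult, Rmult_comm; apply Rmult_le_compat_l; auto using Rabs_pos.
Qed.

Lemma exp_le a b : a <= b -> exp a <= exp b.
Proof. intros [H| ->]; [left; now apply exp_increasing|apply Rle_refl]. Qed.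

Lemma Rabs_cos_le x : Rabs (cos x) <= 1.
Proof. apply Rabs_le, COS_bound. Qed.

Lemma Rabs_sin_le x : Rabs (sin x) <= 1.
Proof. apply Rabs_le, SIN_bound. Qed.

Lemma is_lim_squeeze0 (f g : R -> R) M :
  (forall t, M < t -> Rabs (f t) <= g t) -> is_lim g p_infty 0 -> is_lim f p_infty 0.
Proof.
  intros H Hg.
  apply is_lim_le_le_loc with (f := fun t => - g t) (g := g); auto.
  - exists M; intros t Ht; apply Rabs_le_between; auto.
  - replace (Finite 0) with (Rbar_opp 0) by (simpl; f_equal; ring).
    now apply is_lim_opp.
Qed.

Lemma is_lim_exp_neg : is_lim (fun t => exp (- t)) p_infty 0.
Proof.
  apply (is_lim_comp exp (fun t => - t) p_infty 0 m_infty).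
  - apply is_lim_exp_m.
  - apply (is_lim_opp (fun t => t) p_infty p_infty), is_lim_id.
  - exists 0; discriminate.
Qed.

Definition is_improper (f : R -> R) (l : R) : Prop :=
  is_lim (fun T => RInt f 0 T) p_infty l.

Lemma is_improper_unique f l1 l2 : is_improper f l1 -> is_improper f l2 -> l1 = l2.
Proof.
  intros H1 H2; apply is_lim_unique in H1; apply is_lim_unique in H2.
  rewrite H1 in H2; now injection H2.
Qed.

Lemma is_improper_ext f g l :
  (forall t, 0 <= t -> f t = g t) -> is_improper f l -> is_improper g l.
Proof.
  intros H; apply is_lim_ext_loc; exists 0; intros T HT.
  apply RInt_ext; intros t Ht; apply H; rewrite Rmin_left in Ht; lra.
Qed.

Lemma is_improper_plus f g lf lg :
  (forall t, continuous f t) -> (forall t, continuous g t) ->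
  is_improper f lf -> is_improper g lg -> is_improper (fun t => f t + g t) (lf + lg).
Proof.
  intros cf cg Hf Hg; unfold is_improper.
  apply is_lim_ext with (fun T => RInt f 0 T + RInt g 0 T).
  - intros T; symmetry; apply (RInt_plus (V := R_CompleteNormedModule));
      now apply continuous_ex_RInt.
  - now apply (is_lim_plus' _ _ p_infty lf lg).
Qed.

Lemma is_improper_scal f l k :
  (forall t, continuous f t) ->
  is_improper f l -> is_improper (fun t => k * f t) (k * l).
Proof.
  intros cf Hf; unfold is_improper.
  apply is_lim_ext with (fun T => k * RInt f 0 T).
  - intros T; symmetry; apply (RInt_scal (V := R_CompleteNormedModule));
      now apply continuous_ex_RInt.
  - now apply (is_lim_scal_l _ k p_infty l).
Qed.

Lemma is_improper_le f g lf lg :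
  (forall t, continuous f t) -> (forall t, continuous g t) ->
  (forall t, 0 <= t -> f t <= g t) ->
  is_improper f lf -> is_improper g lg -> lf <= lg.
Proof.
  intros cf cg Hfg Hf Hg.
  apply (is_lim_le_loc _ _ p_infty lf lg) with (2 := Hf) (3 := Hg).
  exists 0; intros T HT; apply RInt_le; try now apply continuous_ex_RInt.
  - lra.
  - intros t Ht; apply Hfg; lra.
Qed.

Lemma is_improper_abs f g lf lg :
  (forall t, continuous f t) -> (forall t, continuous g t) ->
  (forall t, 0 <= t -> Rabs (f t) <= g t) ->
  is_improper f lf -> is_improper g lg -> Rabs lf <= lg.
Proof.
  intros cf cg Hfg Hf Hg; apply Rabs_le; split.
  - assert (- 1 * lf <= lg); [|lra].
    apply (is_improper_le (fun t => - 1 * f t) g); auto.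
    + intros t; apply (continuous_scal_r (V := R_NormedModule)); auto.
    + intros t Ht; specialize (Hfg t Ht); apply Rabs_le_between in Hfg; lra.
    + now apply is_improper_scal.
  - apply (is_improper_le f g); auto.
    intros t Ht; specialize (Hfg t Ht); apply Rabs_le_between in Hfg; lra.
Qed.

Lemma is_improper_derive (G g : R -> R) (L : R) :
  (forall t, is_derive G t (g t)) -> (forall t, continuous g t) ->
  is_lim G p_infty L -> is_improper g (L - G 0).
Proof.
  intros HG Hg HL; unfold is_improper.
  apply is_lim_ext with (fun T => G T - G 0).
  - intros T; symmetry; now apply RInt_primitive.
  - apply (is_lim_minus' _ _ p_infty L (G 0)); auto; apply is_lim_const.
Qed.

Lemma is_improper_primitive (P g : R -> R) (L : R) :
  (forall t, is_derive P t (g t)) -> (forall t, continuous g t) ->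
  is_improper g L -> is_lim P p_infty (L + P 0).
Proof.
  intros HP Hg HL. apply is_lim_ext with (fun T => RInt g 0 T + P 0).
  - intros T; rewrite (RInt_primitive P g); auto; ring.
  - apply (is_lim_plus' _ _ p_infty L (P 0)); [exact HL|apply is_lim_const].
Qed.

Lemma is_improper_exp_neg : is_improper (fun t => exp (- t)) 1.
Proof.
  replace 1 with (0 - (fun t => - exp (- t)) 0) by (rewrite Ropp_0, exp_0; ring).
  apply (is_improper_derive (fun t => - exp (- t))).
  - intros t; auto_derive; auto; ring.
  - smooth.
  - replace (Finite 0) with (Rbar_opp 0) by (simpl; f_equal; ring).
    apply is_lim_opp, is_lim_exp_neg.
Qed.

(** The one integrability criterion used below.  All the integrands decay at least
    like a Gaussian or like the exponential of a negative cubic, and the class is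
    stable under sums and under multiplication by bounded continuous functions. *)
Definition dominated (f : R -> R) : Prop :=
  (forall t, continuous f t) /\
  exists K, forall t, 0 <= t -> Rabs (f t) <= K * exp (- t).

Lemma incr_bounded_lim (F : R -> R) (M : R) :
  (forall x y, 0 <= x -> x <= y -> F x <= F y) ->
  (forall x, 0 <= x -> F x <= M) ->
  exists l : R, is_lim F p_infty l.
Proof.
  intros Hinc Hb.
  destruct (completeness (fun y => exists x, 0 <= x /\ y = F x)) as [l [Hu Hl]].
  - exists M; intros y [x [Hx ->]]; auto.
  - exists (F 0), 0; split; [lra|reflexivity].
  - exists l; apply is_lim_spec; intros e.
    destruct (Classical_Prop.classic (exists x, 0 <= x /\ l - e < F x)) as [[x0 [Hx0 H0]]|Hn].
    + exists x0; intros x Hx.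
      assert (F x <= l) by (apply Hu; exists x; split; [lra|reflexivity]).
      assert (F x0 <= F x) by (apply Hinc; lra).
      apply Rabs_lt_between; lra.
    + exfalso; assert (l <= l - e); [|destruct e; simpl in *; lra].
      apply Hl; intros y [x [Hx ->]].
      destruct (Rle_lt_dec (F x) (l - e)); auto.
      exfalso; apply Hn; exists x; auto.
Qed.

(** With g = K exp(-t) as a majorant, f + g is nonnegative and at most 2 g, so its
    integrals over [0, T] increase and stay bounded; subtract the integral of g. *)
Lemma dominated_improper f : dominated f -> exists l, is_improper f l.
Proof.
  intros [cf [K HK]].
  assert (HK0 : 0 <= K).
  { generalize (HK 0 (Rle_refl 0)) (Rabs_pos (f 0)); rewrite Ropp_0, exp_0; lra. }
  set (g := fun t => K * exp (- t)).
  assert (cg : forall t, continuous g t) by (unfold g; smooth).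
  assert (cs : forall t, continuous (fun t => f t + g t) t).
  { intros t; apply (continuous_plus (V := R_NormedModule)); auto. }
  assert (Hg : is_improper g (K * 1)).
  { apply is_improper_scal; [smooth|apply is_improper_exp_neg]. }
  destruct (incr_bounded_lim (fun T => RInt (fun t => f t + g t) 0 T) (2 * K)) as [l Hl].
  - intros x y Hx Hxy.
    assert (E := RInt_Chasles (V := R_CompleteNormedModule) (fun t => f t + g t) 0 x y
       (continuous_ex_RInt _ _ _ cs) (continuous_ex_RInt _ _ _ cs)).
    unfold plus in E; simpl in E; rewrite <- E.
    assert (0 <= RInt (fun t => f t + g t) x y); [|lra].
    apply RInt_ge_0; auto.
    + now apply continuous_ex_RInt.
    + intros t Ht; assert (H : 0 <= t) by lra; specialize (HK t H).
      apply Rabs_le_between in HK; unfold g; lra.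
  - intros x Hx.
    apply Rle_trans with (RInt (fun t => 2 * g t) 0 x).
    + apply RInt_le; auto; try apply continuous_ex_RInt; auto.
      * intros t; apply (continuous_scal_r (V := R_NormedModule)); auto.
      * intros t Ht; assert (H : 0 <= t) by lra; specialize (HK t H).
        apply Rabs_le_between in HK; unfold g; lra.
    + rewrite (RInt_primitive (fun t => - 2 * K * exp (- t))).
      * rewrite Ropp_0, exp_0. generalize (exp_pos (- x)); nra.
      * intros t; unfold g; auto_derive; auto; ring.
      * unfold g; smooth.
  - exists (l + - 1 * (K * 1)).
    apply is_improper_ext with (fun t => (f t + g t) + - 1 * g t); [intros; ring|].
    apply is_improper_plus; auto.
    + intros t; apply (continuous_scal_r (V := R_NormedModule)); auto.
    + apply is_improper_scal; auto.
Qed.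

(** A total form of the integral, meaningful for dominated f, that can be rewritten with. *)
Definition improper (f : R -> R) : R := real (Lim (fun T => RInt f 0 T) p_infty).

Lemma improper_correct f : dominated f -> is_improper f (improper f).
Proof.
  intros H; destruct (dominated_improper f H) as [l Hl].
  unfold improper; rewrite (is_lim_unique _ _ _ Hl); exact Hl.
Qed.

Lemma is_improper_value f l : is_improper f l -> improper f = l.
Proof. intros Hl; unfold improper; now rewrite (is_lim_unique _ _ _ Hl). Qed.

Lemma dominated_bounded_mult f g M :
  dominated f -> (forall t, continuous g t) -> (forall t, 0 <= t -> Rabs (g t) <= M) ->
  dominated (fun t => f t * g t).
Proof.
  intros [cf [K HK]] cg Hg; split.
  - intros t; apply (continuous_mult (K := R_AbsRing)); auto.
  - exists (K * M); intros t Ht; rewrite Rabs_mult.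
    replace (K * M * exp (- t)) with ((K * exp (- t)) * M) by ring.
    apply Rmult_le_compat; auto using Rabs_pos.
Qed.

Lemma dominated_plus f g :
  dominated f -> dominated g -> dominated (fun t => f t + g t).
Proof.
  intros [cf [K HK]] [cg [L HL]]; split.
  - intros t; apply (continuous_plus (V := R_NormedModule)); auto.
  - exists (K + L); intros t Ht; eapply Rle_trans; [apply Rabs_triang|].
    specialize (HK t Ht); specialize (HL t Ht); lra.
Qed.

Lemma dominated_le f g :
  (forall t, continuous f t) -> dominated g ->
  (forall t, 0 <= t -> Rabs (f t) <= g t) -> dominated f.
Proof.
  intros cf [_ [K HK]] H; split; auto; exists K; intros t Ht.
  eapply Rle_trans; [apply H; auto|]; eapply Rle_trans; [apply Rle_abs|auto].
Qed.

Lemma dominated_scal k f : dominated f -> dominated (fun t => k * f t).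
Proof.
  intros [cf [K HK]]; split.
  - intros t; apply (continuous_scal_r (V := R_NormedModule)); auto.
  - exists (Rabs k * K); intros t Ht; rewrite Rabs_mult, Rmult_assoc.
    apply Rmult_le_compat_l; auto using Rabs_pos.
Qed.

Lemma dominated_lim0 f : dominated f -> is_lim f p_infty 0.
Proof.
  intros [_ [K HK]].
  assert (HL : is_lim (fun t => K * exp (- t)) p_infty 0).
  { replace (Finite 0) with (Rbar_mult K 0) by (simpl; f_equal; ring).
    apply is_lim_scal_l, is_lim_exp_neg. }
  apply is_lim_le_le_loc with (f := fun t => - (K * exp (- t))) (g := fun t => K * exp (- t)); auto.
  - exists 0; intros t Ht; apply Rabs_le_between, HK; lra.
  - replace (Finite 0) with (Rbar_opp 0) by (simpl; f_equal; ring).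
    now apply is_lim_opp.
Qed.

Lemma improper_plus f g :
  dominated f -> dominated g -> improper (fun t => f t + g t) = improper f + improper g.
Proof.
  intros Hf Hg; apply is_improper_value, is_improper_plus; try apply improper_correct; auto;
    [apply Hf|apply Hg].
Qed.

Lemma improper_scal k f : dominated f -> improper (fun t => k * f t) = k * improper f.
Proof.
  intros Hf; apply is_improper_value, is_improper_scal; try apply improper_correct; auto;
    apply Hf.
Qed.

Lemma improper_ext f g : (forall t, 0 <= t -> f t = g t) -> dominated f ->
  improper f = improper g.
Proof.
  intros H Hf; symmetry; apply is_improper_value; apply (is_improper_ext f); auto.
  now apply improper_correct.
Qed.

Lemma improper_abs_le f g :
  dominated f -> dominated g -> (forall t, 0 <= t -> Rabs (f t) <= g t) ->
  Rabs (improper f) <= improper g.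
Proof.
  intros Hf Hg H; apply (is_improper_abs f g); auto using improper_correct;
    [apply Hf|apply Hg].
Qed.

Lemma dominated_sum (f : nat -> R -> R) n :
  (forall k, dominated (f k)) ->
  dominated (fun t => sum_f_R0 (fun k => f k t) n) /\
  improper (fun t => sum_f_R0 (fun k => f k t) n) = sum_f_R0 (fun k => improper (f k)) n.
Proof.
  intros H; induction n as [|n [IH1 IH2]]; [split; [apply (H 0%nat)|reflexivity]|].
  simpl; split; [now apply dominated_plus|].
  rewrite improper_plus, IH2; auto.
Qed.

(** Keep a single term of the exponential series. *)
Lemma pow_le_fact_exp n t : 0 <= t -> t ^ n <= INR (fact n) * exp t.
Proof.
  intros Ht.
  assert (H := exp_ge_taylor t n Ht).
  assert (0 < INR (fact n)) by apply INR_fact_lt_0.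
  assert (t ^ n / INR (fact n) <= exp t).
  { apply Rle_trans with (2 := H).
    destruct n as [|n]; [apply Rle_refl|]; rewrite tech5.
    assert (0 <= sum_f_R0 (fun k => t ^ k / INR (fact k)) n); [|lra].
    apply cond_pos_sum; intros k; apply Rmult_le_pos; [now apply pow_le|].
    left; apply Rinv_0_lt_compat, INR_fact_lt_0. }
  apply Rmult_le_compat_l with (r := INR (fact n)) in H1; [|lra].
  replace (INR (fact n) * (t ^ n / INR (fact n))) with (t ^ n) in H1 by (field; lra); auto.
Qed.

Lemma pow_div_fact_le_exp n t : 0 <= t -> t ^ n / INR (fact n) <= exp t.
Proof.
  intros Ht. assert (H := pow_le_fact_exp n t Ht). assert (F := INR_fact_lt_0 n).
  apply Rle_div_l; lra.
Qed.

Lemma dominated_gauss m a : 0 < a -> dominated (fun t => t ^ m * exp (- a * t ^ 2)).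
Proof.
  intros Ha; split; [smooth|].
  exists (INR (fact m) * exp (/ a)); intros t Ht.
  rewrite Rabs_pos_eq by (apply Rmult_le_pos; [now apply pow_le|left; apply exp_pos]).
  apply Rle_trans with (INR (fact m) * exp t * exp (- a * t ^ 2)).
  - apply Rmult_le_compat_r; [left; apply exp_pos|now apply pow_le_fact_exp].
  - rewrite !Rmult_assoc; apply Rmult_le_compat_l; [apply pos_INR|].
    rewrite <- !exp_plus.
    assert (t + - a * t ^ 2 <= / a + - t).
    (* Completing the square: 2 t - a t^2 <= 1/a. *)
    { assert (0 <= / a * (a * t - 1) ^ 2).
      { apply Rmult_le_pos; [left; now apply Rinv_0_lt_compat|apply pow2_ge_0]. }
      replace (/ a * (a * t - 1) ^ 2) with (a * t ^ 2 - 2 * t + / a) in H by (field; lra); lra. }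
    now apply exp_le.
Qed.

(** Since q^3 >= q - 1 for q = t^2, this weight is below a multiple of a Gaussian one. *)
Lemma dominated_sextic m : dominated (fun t => t ^ m * exp (- t ^ 6)).
Proof.
  apply dominated_le with (fun t => exp 1 * (t ^ m * exp (Ropp 1 * t ^ 2))).
  - smooth.
  - apply dominated_scal, (dominated_gauss m 1); lra.
  - intros t Ht.
    rewrite Rabs_pos_eq by (apply Rmult_le_pos; [now apply pow_le|left; apply exp_pos]).
    replace (exp 1 * (t ^ m * exp (Ropp 1 * t ^ 2))) with (t ^ m * (exp 1 * exp (Ropp 1 * t ^ 2)))
      by ring.
    apply Rmult_le_compat_l; [now apply pow_le|].
    rewrite <- exp_plus; apply exp_le.
    assert (0 <= t ^ 2) by apply pow2_ge_0.
    replace (t ^ 6) with ((t ^ 2) ^ 3) by ring.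
    set (q := t ^ 2) in *; destruct (Rle_dec 1 q); [|assert (0 <= q ^ 3) by (now apply pow_le);
      lra].
    assert (q ^ 3 >= q) by nra; lra.
Qed.

(** * Cauchy's theorem for exponentials of holomorphic functions *)

Definition continuous2 (f : R -> R -> R) := forall a b, continuity_2d_pt f a b.

Lemma continuous2_snd f a b : continuous2 f -> continuous (f a) b.
Proof.
  intros H; specialize (H a b); apply continuity_2d_pt_filterlim in H.
  apply (filterlim_comp _ _ _ (fun b => (a, b)) (fun z => f (fst z) (snd z)) _ (locally (a, b)));
    auto.
  apply (continuous_comp_2 (fun _ => a) (fun b => b) (fun x y => (x, y))).
  - apply continuous_const.
  - apply continuous_id.
  - intros P HP; simpl in HP. apply (filter_imp (F := locally (a, b))) with P; auto. intros [x y];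
      auto.
Qed.

Lemma continuous2_fst f a b : continuous2 f -> continuous (fun a => f a b) a.
Proof.
  intros H; specialize (H a b); apply continuity_2d_pt_filterlim in H.
  apply (filterlim_comp _ _ _ (fun a => (a, b)) (fun z => f (fst z) (snd z)) _ (locally (a, b)));
    auto.
  apply (continuous_comp_2 (fun a => a) (fun _ => b) (fun x y => (x, y))).
  - apply continuous_id.
  - apply continuous_const.
  - intros P HP; simpl in HP. apply (filter_imp (F := locally (a, b))) with P; auto. intros [x y];
      auto.
Qed.

Lemma continuous2_1d (f : R -> R) (g : R -> R -> R) :
  (forall t, continuous f t) -> continuous2 g -> continuous2 (fun a b => f (g a b)).
Proof.
  intros Hf Hg a b; apply continuity_1d_2d_pt_comp; auto.
  apply continuity_pt_filterlim, Hf.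
Qed.

Ltac smooth2 :=
  repeat first
    [ match goal with |- continuity_2d_pt (fun a b => exp (@?g a b)) _ _ =>
        apply (continuous2_1d exp g); [smooth|intros ? ?] end
    | match goal with |- continuity_2d_pt (fun a b => cos (@?g a b)) _ _ =>
        apply (continuous2_1d cos g); [smooth|intros ? ?] end
    | match goal with |- continuity_2d_pt (fun a b => sin (@?g a b)) _ _ =>
        apply (continuous2_1d sin g); [smooth|intros ? ?] end
    | match goal with |- continuity_2d_pt (fun a b => (@?g a b) ^ ?n) _ _ =>
        apply (continuous2_1d (fun t => t ^ n) g); [smooth|intros ? ?] end
    | match goal with H : continuous2 _ |- _ => apply H end
    | apply continuity_2d_pt_plus
    | apply continuity_2d_pt_minus
    | apply continuity_2d_pt_mult
    | apply continuity_2d_pt_opp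
    | apply continuity_2d_pt_const
    | apply continuity_2d_pt_id1
    | apply continuity_2d_pt_id2
    ].

(** Poincare's lemma: integrate the form p da + q db along the horizontal axis and
    then vertically.  Closedness, [r] being the common cross derivative, gives the
    derivative in a by differentiation under the integral sign.  The conclusion is a
    chain rule along curves because the contours below include slanted lines. *)
Lemma closed_form_potential (p q r : R -> R -> R) :
  (forall a b, is_derive (fun b => p a b) b (r a b)) ->
  (forall a b, is_derive (fun a => q a b) a (r a b)) ->
  continuous2 p -> continuous2 q -> continuous2 r ->
  exists Phi : R -> R -> R, forall (al be : R -> R) t al' be',
    is_derive al t al' -> is_derive be t be' ->
    is_derive (fun t => Phi (al t) (be t)) t
      (p (al t) (be t) * al' + q (al t) (be t) * be').
Proof.
  intros Hp Hq cp cq cr.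
  set (Phi := fun a b => RInt (fun s => p s 0) 0 a + RInt (q a) 0 b).
  assert (Ha : forall a b, is_derive (fun a => Phi a b) a (p a b)).
  { intros a b; unfold Phi.
    replace (p a b) with (p a 0 + RInt (fun s => Derive (fun a => q a s) a) 0 b).
    - apply (is_derive_plus (V := R_NormedModule)).
      + apply (is_derive_RInt (V := R_NormedModule) (fun s => p s 0) _ 0).
        * apply filter_forall; intros x. 
          apply (RInt_correct (V := R_CompleteNormedModule)), continuous_ex_RInt; intros t;
            now apply continuous2_fst.
        * now apply continuous2_fst.
      + apply (is_derive_RInt_param (fun a s => q a s)).
        * apply filter_forall; intros x t _; exists (r x t); apply Hq.
        * intros t _; apply continuity_2d_pt_ext with r; auto.
          intros x y; symmetry; apply is_derive_unique, Hq.
        * apply filter_forall; intros x; apply continuous_ex_RInt; intros t;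
            now apply continuous2_snd.
    - rewrite (RInt_ext _ (r a)) by (intros; apply is_derive_unique, Hq).
      rewrite (RInt_primitive (p a)); auto.
      + ring.
      + intros t; now apply continuous2_snd. }
  assert (Hb : forall a b, is_derive (Phi a) b (q a b)).
  { intros a b; unfold Phi.
    replace (q a b) with (plus 0 (q a b)) by (unfold plus; simpl; ring).
    apply (is_derive_plus (V := R_NormedModule)).
    - apply (is_derive_const (V := R_NormedModule)).
    - apply (is_derive_RInt (V := R_NormedModule) (q a) _ 0).
      + apply filter_forall; intros x.
        apply (RInt_correct (V := R_CompleteNormedModule)), continuous_ex_RInt; intros t;
          now apply continuous2_snd.
      + now apply continuous2_snd. }
  exists Phi; intros al be t al' be' Hal Hbe.
  apply is_derive_Reals, derivable_pt_lim_comp_2d; try now apply is_derive_Reals.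
  apply filterdiff_differentiable_pt_lim.
  apply (is_derive_filterdiff Phi (al t) (be t) p (q (al t) (be t))).
  - apply filter_forall; intros [x y]; apply Ha.
  - apply Hb.
  - apply continuity_2d_pt_filterlim, cp.
Qed.

(** Cauchy's theorem: G1 + i G2 satisfies the Cauchy-Riemann equations and has
    derivative g + i h, so the real and the imaginary part of exp(G1 + i G2) ds are
    closed forms.  [P1] and [P2] are the two parts of a holomorphic primitive. *)
Lemma exp_primitive (G1 G2 g h : R -> R -> R) :
  (forall a b, is_derive (fun a => G1 a b) a (g a b)) ->
  (forall a b, is_derive (fun b => G1 a b) b (- h a b)) ->
  (forall a b, is_derive (fun a => G2 a b) a (h a b)) ->
  (forall a b, is_derive (fun b => G2 a b) b (g a b)) ->
  continuous2 G1 -> continuous2 G2 -> continuous2 g -> continuous2 h ->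
  exists P1 P2 : R -> R -> R,
    (forall (al be : R -> R) t al' be', is_derive al t al' -> is_derive be t be' ->
      is_derive (fun t => P1 (al t) (be t)) t
        (exp (G1 (al t) (be t)) * (cos (G2 (al t) (be t)) * al' + - sin (G2 (al t) (be t)) *
          be'))) /\
    (forall (al be : R -> R) t al' be', is_derive al t al' -> is_derive be t be' ->
      is_derive (fun t => P2 (al t) (be t)) t
        (exp (G1 (al t) (be t)) * (sin (G2 (al t) (be t)) * al' + cos (G2 (al t) (be t)) * be'))).
Proof.
  intros H1a H1b H2a H2b c1 c2 cg ch.
  destruct (closed_form_potential
     (fun a b => exp (G1 a b) * cos (G2 a b)) (fun a b => - (exp (G1 a b) * sin (G2 a b)))
     (fun a b => exp (G1 a b) * (- h a b * cos (G2 a b) - g a b * sin (G2 a b)))) as [P1 HP1].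
  - intros a b; evar_last.
    + apply (is_derive_mult (K := R_AbsRing) (fun b => exp (G1 a b)) (fun b => cos (G2 a b))).
      * apply (is_derive_comp (V := R_NormedModule) exp (G1 a)); [apply is_derive_exp|apply H1b].
      * apply (is_derive_comp (V := R_NormedModule) cos (G2 a)); [apply is_derive_cos|apply H2b].
      * intros; apply Rmult_comm.
    + unfold scal, plus, mult; simpl; unfold mult; simpl; ring.
  - intros a b; evar_last.
    + apply (is_derive_opp (V := R_NormedModule)).
      apply (is_derive_mult (K := R_AbsRing) (fun a => exp (G1 a b)) (fun a => sin (G2 a b))).
      * apply (is_derive_comp (V := R_NormedModule) exp (fun a => G1 a b));
          [apply is_derive_exp|apply H1a].
      * apply (is_derive_comp (V := R_NormedModule) sin (fun a => G2 a b));
          [apply is_derive_sin|apply H2a].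
      * intros; apply Rmult_comm.
    + unfold scal, plus, mult, opp; simpl; unfold mult; simpl; ring.
  - intros a b; smooth2.
  - intros a b; smooth2.
  - intros a b; smooth2.
  - destruct (closed_form_potential
     (fun a b => exp (G1 a b) * sin (G2 a b)) (fun a b => exp (G1 a b) * cos (G2 a b))
     (fun a b => exp (G1 a b) * (g a b * cos (G2 a b) - h a b * sin (G2 a b)))) as [P2 HP2].
    + intros a b; evar_last.
      * apply (is_derive_mult (K := R_AbsRing) (fun b => exp (G1 a b)) (fun b => sin (G2 a b))).
        -- apply (is_derive_comp (V := R_NormedModule) exp (G1 a)); [apply is_derive_exp|apply H1b].
        -- apply (is_derive_comp (V := R_NormedModule) sin (G2 a)); [apply is_derive_sin|apply H2b].
        -- intros; apply Rmult_comm.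
      * unfold scal, plus, mult; simpl; unfold mult; simpl; ring.
    + intros a b; evar_last.
      * apply (is_derive_mult (K := R_AbsRing) (fun a => exp (G1 a b)) (fun a => cos (G2 a b))).
        -- apply (is_derive_comp (V := R_NormedModule) exp (fun a => G1 a b));
             [apply is_derive_exp|apply H1a].
        -- apply (is_derive_comp (V := R_NormedModule) cos (fun a => G2 a b));
             [apply is_derive_cos|apply H2a].
        -- intros; apply Rmult_comm.
      * unfold scal, plus, mult; simpl; unfold mult; simpl; ring.
    + intros a b; smooth2.
    + intros a b; smooth2.
    + intros a b; smooth2.
    + exists P1, P2; split; intros al be t al' be' Ha Hb.
      * evar_last; [exact (HP1 al be t al' be' Ha Hb)|simpl; ring].
      * evar_last; [exact (HP2 al be t al' be' Ha Hb)|simpl; ring].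
Qed.

(** * Gaussian and Gamma integrals *)

Section Product.

Variable k : nat.
Hypothesis Hpos : forall v : R, 0 < 1 + v ^ (S (S k)).
Let n := S (S k).
Let f1 := fun x => exp (- x ^ n).
Let f2 := fun y => y ^ k * exp (- y ^ n).
Let Q := fun T v => (1 + v ^ k) / (1 + v ^ n) * (1 - exp (- (T ^ n * (1 + v ^ n)))).

(** The substitution t = T v, which puts both integrals of the product over [0, 1]. *)
Lemma RInt_dilate (g : R -> R) T : (forall t, continuous g t) ->
  RInt g 0 T = RInt (fun v => T * g (T * v)) 0 1.
Proof.
  intros cg.
  assert (E := RInt_comp_lin (V := R_CompleteNormedModule) g T 0 0 1).
  replace (T * 0 + 0) with 0 in E by ring; replace (T * 1 + 0) with T in E by ring.
  rewrite <- E; [|now apply continuous_ex_RInt].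
  apply RInt_ext; intros; unfold scal; simpl; unfold mult; simpl; rewrite Rplus_0_r; auto.
Qed.

Lemma cont_f1 : forall t, continuous f1 t.
Proof. unfold f1; smooth. Qed.

Lemma cont_f2 : forall t, continuous f2 t.
Proof. unfold f2; smooth. Qed.

Lemma derive_Q T v : is_derive (fun T => Q T v) T (INR n * T ^ (S k) * (1 + v ^ k) * exp
  (- (T ^ n * (1 + v ^ n)))).
Proof.
  assert (H : forall m c d, is_derive (fun T => d / c * (1 - exp (- (T ^ m * c)))) T
    (d / c * (INR m * T ^ pred m * c * exp (- (T ^ m * c))))).
  { intros m c d; auto_derive; auto; ring. }
  assert (Pv := Hpos v); fold n in Pv.
  evar_last; [apply H|]. change (Nat.pred n) with (S k). field; lra.
Qed.

Lemma cont_Q T v : continuous (Q T) v.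
Proof. unfold Q; smooth. apply Rgt_not_eq, Hpos. Qed.

(** The product of the two integrals over [0, T] is an integral over a square, which
    polar-like coordinates (the ratio v of the two variables, split at v = 1) turn
    into the right-hand side.  The proof avoids double integrals: both sides vanish
    at T = 0 and have the same derivative in T. *)
Lemma product_formula T :
  RInt f1 0 T * RInt f2 0 T = / INR n * RInt (Q T) 0 1.
Proof.
  assert (Hn : INR n <> 0) by (apply not_0_INR; discriminate).
  set (D := fun T => RInt f1 0 T * RInt f2 0 T - / INR n * RInt (Q T) 0 1).
  assert (HD : forall T, is_derive D T 0).
  { intros S0; unfold D.
    evar_last.
    - apply (is_derive_minus (V := R_NormedModule)).
      + apply (is_derive_mult (K := R_AbsRing) (fun T => RInt f1 0 T) (fun T => RInt f2 0 T)).
        * apply (is_derive_RInt (V := R_NormedModule) f1 _ 0); [|apply cont_f1].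
          apply filter_forall; intros x; apply (RInt_correct (V := R_CompleteNormedModule)),
            continuous_ex_RInt, cont_f1.
        * apply (is_derive_RInt (V := R_NormedModule) f2 _ 0); [|apply cont_f2].
          apply filter_forall; intros x; apply (RInt_correct (V := R_CompleteNormedModule)),
            continuous_ex_RInt, cont_f2.
        * intros; apply Rmult_comm.
      + apply (is_derive_scal (fun T => RInt (Q T) 0 1)).
        apply (is_derive_RInt_param (fun T v => Q T v)).
        * apply filter_forall; intros x t _; eexists; apply derive_Q.
        * intros t _; apply continuity_2d_pt_ext with
            (fun T v => INR n * T ^ (S k) * (1 + v ^ k) * exp (- (T ^ n * (1 + v ^ n)))).
          -- intros x y; symmetry; apply is_derive_unique, derive_Q.
          -- smooth2.
        * apply filter_forall; intros x; apply continuous_ex_RInt; intros v; apply cont_Q.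
    - rewrite (RInt_ext (fun t => Derive (fun u => Q u t) S0)
        (fun v => INR n * (f1 S0 * (S0 * f2 (S0 * v)) + f2 S0 * (S0 * f1 (S0 * v))))).
      + rewrite (RInt_dilate f1) by apply cont_f1; rewrite (RInt_dilate f2) by apply cont_f2.
        set (g1 := fun v => S0 * f1 (S0 * v)); set (g2 := fun v => S0 * f2 (S0 * v)).
        assert (c1 : forall v, continuous g1 v) by (unfold g1, f1; smooth).
        assert (c2 : forall v, continuous g2 v) by (unfold g2, f2; smooth).
        rewrite (is_RInt_unique (V := R_CompleteNormedModule)
          (fun v => INR n * (f1 S0 * (S0 * f2 (S0 * v)) + f2 S0 * (S0 * f1 (S0 * v)))) 0 1
          (INR n * (f1 S0 * RInt g2 0 1 + f2 S0 * RInt g1 0 1))).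
        * revert Hn; generalize (INR n); intros N HN.
          unfold scal, plus, minus, opp; simpl; unfold mult; simpl; unfold minus, plus, opp; simpl.
          field; auto.
        * apply (is_RInt_scal (V := R_NormedModule)
            (fun v => f1 S0 * g2 v + f2 S0 * g1 v)).
          apply (is_RInt_plus (V := R_NormedModule) (fun v => f1 S0 * g2 v)
            (fun v => f2 S0 * g1 v));
            apply (is_RInt_scal (V := R_NormedModule));
            now apply (RInt_correct (V := R_CompleteNormedModule)), continuous_ex_RInt.
      + intros v _; etransitivity; [apply is_derive_unique, derive_Q|].
        unfold f1, f2. rewrite !Rpow_mult_distr.
        replace (- (S0 ^ n * (1 + v ^ n))) with (- S0 ^ n + - (S0 ^ n * v ^ n)) by ring.
        rewrite exp_plus. change (S0 ^ S k) with (S0 * S0 ^ k). in_reals; ring. }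
  assert (E : D T = D 0).
  { assert (H : Rabs (D T - D 0) <= Rabs (T - 0) * 0).
    { apply (derive_bounded_variation D (fun _ => 0)); auto.
      intros; rewrite Rabs_R0; lra. }
    rewrite Rmult_0_r in H. assert (H' := Rabs_pos (D T - D 0)).
    assert (H2 : Rabs (D T - D 0) = 0) by lra.
    destruct (Req_dec (D T - D 0) 0) as [?|N]; [lra|]. apply Rabs_no_R0 in N; lra. }
  assert (E0 : D 0 = 0).
  { unfold D; rewrite !RInt_point. rewrite (RInt_ext _ (fun _ => 0)).
    - rewrite RInt_const; unfold zero, scal; simpl; unfold mult; simpl; in_reals; ring.
    - intros v _; unfold Q. simpl (0 ^ n). rewrite !Rmult_0_l, Ropp_0, exp_0; in_reals; ring. }
  unfold D in E at 1; lra.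
Qed.

(** For k = 0 this is the classical evaluation of the Gaussian integral, and for k = 4
    the reflection formula of Gamma at 1/6, both reduced to a rational integral. *)
Lemma improper_product l1 l2 :
  is_improper f1 l1 -> is_improper f2 l2 ->
  l1 * l2 = / INR n * RInt (fun v => (1 + v ^ k) / (1 + v ^ n)) 0 1.
Proof.
  intros H1 H2.
  assert (Hn : 1 <= INR n) by (unfold n; rewrite !S_INR; generalize (pos_INR k); lra).
  set (J := RInt (fun v => (1 + v ^ k) / (1 + v ^ n)) 0 1).
  assert (cq : forall v, continuous (fun v => (1 + v ^ k) / (1 + v ^ n)) v).
  { smooth; apply Rgt_not_eq, Hpos. }
  assert (L1 : is_lim (fun T => RInt f1 0 T * RInt f2 0 T) p_infty (l1 * l2)).
  { now apply (is_lim_mult _ _ p_infty l1 l2). }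
  assert (L2 : is_lim (fun T => RInt f1 0 T * RInt f2 0 T) p_infty (/ INR n * J)).
  { apply is_lim_le_le_loc with (f := fun T => / INR n * J - 2 * exp (- T))
      (g := fun T => / INR n * J + 2 * exp (- T)).
    - exists 1; intros T HT; rewrite product_formula.
      assert (B : Rabs (RInt (fun v => Q T v - (1 + v ^ k) / (1 + v ^ n)) 0 1) <= (1 - 0) *
        (2 * exp (- T))).
      { apply abs_RInt_le_const.
        - lra.
        - apply continuous_ex_RInt; intros v; apply (continuous_minus (V := R_NormedModule));
            [apply cont_Q|apply cq].
        - intros v Hv; unfold Q.
          assert (Pv := Hpos v); fold n in Pv.
          assert (P1 : 0 <= v ^ n) by (apply pow_le; lra).
          assert (P2 : 0 <= v ^ k <= 1).
          { split; [apply pow_le; lra|]. rewrite <- (pow1 k); apply pow_incr; lra. }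
          replace (_ - _) with (- ((1 + v ^ k) / (1 + v ^ n) * exp (- (T ^ n * (1 + v ^ n)))))
            by ring.
          rewrite Rabs_Ropp, Rabs_pos_eq.
          + apply Rmult_le_compat.
            * apply Rmult_le_pos; [lra|left; now apply Rinv_0_lt_compat].
            * left; apply exp_pos.
            * apply Rle_div_l; [lra|]. nra.
            * apply exp_le. assert (T <= T ^ n); [|nra].
              replace T with (T * 1) at 1 by ring. unfold n; simpl (T ^ _).
              apply Rmult_le_compat_l; [lra|]. apply (pow_R1_Rle T (S k)); lra.
          + apply Rmult_le_pos; [|left; apply exp_pos].
            apply Rmult_le_pos; [lra|left; now apply Rinv_0_lt_compat]. }
      assert (E : RInt (fun v => Q T v - (1 + v ^ k) / (1 + v ^ n)) 0 1 = RInt (Q T) 0 1 - J).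
      { apply (RInt_minus (V := R_CompleteNormedModule)); apply continuous_ex_RInt; auto.
        intros v; apply cont_Q. }
      rewrite E in B; apply Rabs_le_between in B.
      assert (I : 0 < / INR n <= 1).
      { split; [apply Rinv_0_lt_compat; lra|]. rewrite <- Rinv_1; apply Rinv_le_contravar; lra. }
      assert (0 < exp (- T)) by apply exp_pos.
      set (x := RInt (Q T) 0 1) in *; set (i := / INR n) in *.
      change (R_CompleteNormedModule : Type) with R in *.
      clearbody x i J. split; nra.
    - replace (Finite (/ INR n * J)) with (Finite (/ INR n * J - 2 * 0)) by (f_equal; ring).
      apply (is_lim_minus' _ _ p_infty (/ INR n * J) (2 * 0)); [apply is_lim_const|].
      apply (is_lim_scal_l _ 2 p_infty 0), is_lim_exp_neg.
    - replace (Finite (/ INR n * J)) with (Finite (/ INR n * J + 2 * 0)) by (f_equal; ring).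
      apply (is_lim_plus' _ _ p_infty (/ INR n * J) (2 * 0)); [apply is_lim_const|].
      apply (is_lim_scal_l _ 2 p_infty 0), is_lim_exp_neg. }
  apply is_lim_unique in L1; apply is_lim_unique in L2; rewrite L1 in L2; now injection L2.
Qed.

End Product.

(** The substitution t = y^6 turns Gamma at multiples of 1/6 into integrals with
    polynomial weights, which are smooth at 0. *)
Definition sextic_moment (m : nat) : R := improper (fun y => y ^ m * exp (- y ^ 6)).

Lemma sextic_moment_correct m : is_improper (fun y => y ^ m * exp (- y ^ 6)) (sextic_moment m).
Proof. apply improper_correct, dominated_sextic. Qed.

Lemma sextic_moment_rec m : sextic_moment (6 + m) = (INR m + 1) / 6 * sextic_moment m.
Proof.
  assert (H : is_improper (fun y => (INR m + 1) * (y ^ m * exp (- y ^ 6)) + -6 *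
    (y ^ (6 + m) * exp (- y ^ 6)))
     (0 - (fun y => y ^ (S m) * exp (- y ^ 6)) 0)).
  { apply (is_improper_derive (fun y => y ^ (S m) * exp (- y ^ 6))).
    - intros t.
      assert (D : forall p q, is_derive (fun y => y ^ p * exp (- y ^ q)) t
        (INR p * t ^ pred p * exp (- t ^ q) - INR q * t ^ pred q * t ^ p * exp (- t ^ q))).
      { intros p q; auto_derive; auto; ring. }
      evar_last; [apply D|]. rewrite S_INR, pow_add; simpl Nat.pred; simpl (INR 6); in_reals.
      change (t ^ S m) with (t * t ^ m); ring.
    - smooth.
    - apply dominated_lim0, dominated_sextic. }
  assert (H2 : is_improper (fun y => (INR m + 1) * (y ^ m * exp (- y ^ 6)) + -6 *
    (y ^ (6 + m) * exp (- y ^ 6)))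
    ((INR m + 1) * sextic_moment m + -6 * sextic_moment (6 + m))).
  { apply is_improper_plus; try smooth; apply is_improper_scal; try smooth;
      apply sextic_moment_correct. }
  assert (E := is_improper_unique _ _ _ H H2). cbv beta in E; rewrite pow_i in E by lia; lra.
Qed.

(** (1 + v^4) / (1 + v^6) = 1 / (1 + v^2) + v^2 / (1 + v^6), with primitive
    atan v + atan (v^3) / 3. *)
Lemma sextic_moment_0_4 : sextic_moment 0 * sextic_moment 4 = PI / 18.
Proof.
  assert (Hpos : forall v : R, 0 < 1 + v ^ 6).
  { intros v; assert (0 <= (v ^ 3) ^ 2) by apply pow2_ge_0. replace (v ^ 6) with ((v ^ 3) ^ 2)
      by ring; lra. }
  rewrite (improper_product 4 Hpos (sextic_moment 0) (sextic_moment 4)).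
  - rewrite (RInt_primitive (fun v => atan v + / 3 * atan (v ^ 3))).
    + rewrite pow1, pow_i by lia. rewrite atan_1, atan_0. simpl INR. field.
    + intros v; auto_derive; auto.
      assert (P := Hpos v). assert (0 <= v ^ 2) by apply pow2_ge_0. 
      field. repeat split; apply Rgt_not_eq; nra.
    + smooth. apply Rgt_not_eq, Hpos.
  - apply is_improper_ext with (2 := sextic_moment_correct 0); intros; simpl; ring.
  - apply sextic_moment_correct.
Qed.

Lemma gauss_half : is_improper (fun t => exp (- t ^ 2)) (sqrt PI / 2).
Proof.
  assert (Hpos : forall v : R, 0 < 1 + v ^ 2).
  { intros v; assert (0 <= v ^ 2) by apply pow2_ge_0; lra. }
  assert (D : dominated (fun t => exp (- t ^ 2))).
  { apply dominated_le with (fun t => t ^ 0 * exp (Ropp 1 * t ^ 2)).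
    - smooth.
    - apply (dominated_gauss 0 1); lra.
    - intros t Ht; rewrite Rabs_pos_eq by (left; apply exp_pos).
      right; simpl (t ^ 0); rewrite Rmult_1_l; f_equal; ring. }
  assert (H := improper_correct _ D); set (N := improper _) in H.
  assert (E := improper_product 0 Hpos N N H).
  assert (HN : 0 <= N).
  { apply (is_improper_le (fun _ => 0) (fun t => exp (- t ^ 2)) 0 N) with (5 := H).
    - intros t; apply continuous_const.
    - smooth.
    - intros; left; apply exp_pos.
    - unfold is_improper; apply is_lim_ext with (fun _ => 0); [|apply is_lim_const].
      intros T; rewrite RInt_const; unfold scal; simpl; unfold mult; simpl; in_reals; ring. }
  rewrite (RInt_primitive (fun v => 2 * atan v)) in E.
  - rewrite atan_1, atan_0 in E. simpl INR in E.
    assert (E' : N * N = PI / 4).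
    { rewrite E; [field|]. apply is_improper_ext with (2 := H); intros; simpl; ring. }
    replace (sqrt PI / 2) with N; [exact H|].
    replace PI with ((2 * N) * (2 * N)) by lra.
    rewrite sqrt_square by lra; field.
  - intros v; auto_derive; auto.
    assert (P := Hpos v). field. lra.
  - smooth. apply Rgt_not_eq, Hpos.
Qed.

(** Substitute t = y^6; the primitive [H] is continuous at 0, which settles the end at 0+. *)
Lemma Gamma_sextic m : Gamma ((INR m + 1) / 6) = 6 * sextic_moment m.
Proof.
  set (g := fun y => 6 * (y ^ m * exp (- y ^ 6))).
  assert (cg : forall t, continuous g t) by (unfold g; smooth).
  set (H := fun y => RInt g 0 y).
  assert (HD : forall y, is_derive H y (g y)).
  { intros y; apply (is_derive_RInt (V := R_NormedModule) g _ 0); auto.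
    apply filter_forall; intros x; apply (RInt_correct (V := R_CompleteNormedModule)),
      continuous_ex_RInt, cg. }
  assert (HL : is_lim H p_infty (6 * sextic_moment m)).
  { apply (is_improper_scal (fun y => y ^ m * exp (- y ^ 6)));
      [smooth|apply sextic_moment_correct]. }
  set (r := fun t => Rpower t (/ 6)).
  unfold Gamma; apply is_RInt_gen_unique; try apply _.
  apply (filterlimi_lim_ext_loc (fun ab => H (r (snd ab)) - H (r (fst ab)))).
  - apply Filter_prod with (Q := fun a => 0 < a) (R := fun b => 0 < b).
    + exists (mkposreal 1 Rlt_0_1); intros y _ Hy; exact Hy.
    + exists 0; auto.
    + intros a b Ha Hb; simpl.
      apply (is_RInt_derive (V := R_CompleteNormedModule) (fun t => H (r t))).
      * intros t Ht.
        assert (t0 : 0 < t) by (apply Rlt_le_trans with (2 := proj1 Ht); now apply Rmin_glb_lt).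
        evar_last.
        -- apply (is_derive_comp (V := R_NormedModule) H r); [apply HD|].
           unfold r, Rpower; auto_derive; [auto|reflexivity].
        -- unfold scal, g, r; simpl; unfold mult; simpl; in_reals.
           fold (Rpower t (/ 6)); set (w := Rpower t (/ 6)).
           assert (W6 : w ^ 6 = t).
           { rewrite <- Rpower_pow by apply exp_pos. unfold w; rewrite Rpower_mult.
             replace (/ 6 * INR 6) with 1 by (simpl; field); now apply Rpower_1. }
           assert (Wm : Rpower t ((INR m + 1) / 6 - 1) = w * w ^ m * / t).
           { rewrite <- (Rpower_pow m w) by apply exp_pos. unfold w; rewrite Rpower_mult.
             rewrite <- (Rpower_1 t) at 4 by auto. rewrite <- Rpower_Ropp, <- !Rpower_plus.
             f_equal; field. }
           rewrite Wm. change (w * (w * (w * (w * (w * (w * 1)))))) with (w ^ 6); rewrite W6.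
           field; lra.
      * intros t Ht.
        assert (t0 : 0 < t) by (apply Rlt_le_trans with (2 := proj1 Ht); now apply Rmin_glb_lt).
        unfold Rpower; smooth.
  - replace (6 * sextic_moment m) with (plus (6 * sextic_moment m) (- H 0)).
    2: { unfold H; rewrite RInt_point; unfold plus, zero; simpl; ring. }
    apply (filterlim_comp_2 (G := locally (6 * sextic_moment m)) (H := locally (- H 0))
       (fun ab => H (r (snd ab))) (fun ab => - H (r (fst ab))) (fun x y => plus x y)).
    + apply (filterlim_comp _ _ _ snd (fun b => H (r b)) _ (Rbar_locally p_infty)).
      * apply filterlim_snd.
      * apply (filterlim_comp _ _ _ r H _ (Rbar_locally p_infty)); [|exact HL].
        apply (filterlim_comp _ _ _ (fun b => / 6 * ln b) exp _ (Rbar_locally p_infty));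
          [|apply is_lim_exp_p].
        evar_last. apply (is_lim_scal_l ln (/ 6) p_infty p_infty), is_lim_ln_p. 
        simpl. destruct (Rle_dec 0 (/ 6)) as [h|h]; [|exfalso; lra].
        destruct (Rle_lt_or_eq_dec 0 (/ 6) h); [reflexivity|exfalso; lra].
    + apply (filterlim_comp _ _ _ fst (fun b => - H (r b)) _ (at_right 0)).
      * apply filterlim_fst.
      * apply (filterlim_comp _ _ _ r (fun y => - H y) _ (locally 0)).
        -- apply (filterlim_comp _ _ _ (fun b => / 6 * ln b) exp _ (Rbar_locally m_infty));
             [|apply is_lim_exp_m].
           apply (filterlim_comp _ _ _ ln (fun y => / 6 * y) _ (Rbar_locally m_infty));
             [apply is_lim_ln_0|].
           evar_last. apply (is_lim_scal_l (fun y => y) (/ 6) m_infty m_infty), is_lim_id.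
           simpl. destruct (Rle_dec 0 (/ 6)) as [h|h]; [|exfalso; lra].
           destruct (Rle_lt_or_eq_dec 0 (/ 6) h); [reflexivity|exfalso; lra].
        -- apply (continuous_opp (V := R_NormedModule) H).
           apply (ex_derive_continuous (V := R_NormedModule)); eexists; apply HD.
    + apply (filterlim_plus (V := R_NormedModule)).
Qed.

(** Gamma(1/6) Gamma(5/6) = 36 * PI / 18. *)
Lemma airy_coef_0 : airy_coef 0 = 2 * PI.
Proof.
  unfold airy_coef. assert (H := sextic_moment_0_4).
  replace (INR 0 + 5 / 6) with ((INR 4 + 1) / 6) by (simpl; field).
  replace (INR 0 + 1 / 6) with ((INR 0 + 1) / 6) by (simpl; field).
  rewrite !Gamma_sextic. simpl fact; simpl INR; simpl pow.
  replace (_ / _ * _) with (36 * (sextic_moment 0 * sextic_moment 4)) by field. rewrite H; field.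
Qed.

Lemma airy_coef_rec n :
  airy_coef (S n) = (6 * INR n + 5) * (6 * INR n + 1) / (48 * (INR n + 1)) * airy_coef n.
Proof.
  assert (G5 : forall n, Gamma (INR n + 5 / 6) = 6 * sextic_moment (6 * n + 4)).
  { intros p; rewrite <- Gamma_sextic; f_equal; rewrite plus_INR, mult_INR; simpl; field. }
  assert (G1 : forall n, Gamma (INR n + 1 / 6) = 6 * sextic_moment (6 * n)).
  { intros p; rewrite <- Gamma_sextic; f_equal; rewrite mult_INR; simpl; field. }
  unfold airy_coef; rewrite !G5, !G1.
  replace (6 * S n + 4)%nat with (6 + (6 * n + 4))%nat by lia.
  replace (6 * S n)%nat with (6 + (6 * n))%nat by lia.
  rewrite !sextic_moment_rec, plus_INR, mult_INR, fact_simpl, !mult_INR.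
  change ((3 / 4) ^ S n) with (3 / 4 * (3 / 4) ^ n).
  replace (INR 6) with 6 by (simpl; ring); replace (INR 4) with 4 by (simpl; ring).
  rewrite S_INR.
  assert (0 <= INR n) by apply pos_INR. assert (F := INR_fact_neq_0 n).
  field; split; auto; lra.
Qed.

Lemma airy_coef_pos n : 0 < airy_coef n.
Proof.
  induction n as [|n IH].
  - rewrite airy_coef_0; assert (P := PI_RGT_0); lra.
  - rewrite airy_coef_rec. assert (0 <= INR n) by apply pos_INR.
    apply Rmult_lt_0_compat; auto. apply Rmult_lt_0_compat; [nra|apply Rinv_0_lt_compat; lra].
Qed.

(** * Moments of the rotated Gaussian *)

(** The real part of e^(i phi) rho^m exp(- e^(i PI/6) rho^2): a Gaussian moment
    along a rotated ray, with a free phase phi so that no complex numbers are needed. *)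
Definition gauss_kernel (m : nat) (phi rho : R) : R :=
  rho ^ m * exp (- (sqrt 3 / 2) * rho ^ 2) * cos (phi - rho ^ 2 / 2).

Definition rotated_moment (m : nat) (phi : R) : R := improper (gauss_kernel m phi).

Lemma sqrt3_half_pos : 0 < sqrt 3 / 2.
Proof. assert (0 < sqrt 3) by (apply sqrt_lt_R0; lra); lra. Qed.

Lemma dominated_kernel m phi : dominated (gauss_kernel m phi).
Proof.
  unfold gauss_kernel.
  apply (dominated_bounded_mult (fun rho => rho ^ m * exp (- (sqrt 3 / 2) * rho ^ 2)) _ 1).
  - apply dominated_gauss, sqrt3_half_pos.
  - smooth.
  - intros; apply Rabs_cos_le.
Qed.

(** Integration by parts; dividing by the complex number e^(i PI/6) is a shift of the
    phase by PI/6. *)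
Lemma rotated_moment_rec m phi :
  rotated_moment (2 + m) phi = (INR m + 1) / 2 * rotated_moment m (phi - PI / 6).
Proof.
  set (psi := phi - PI / 6).
  assert (H : is_improper (fun r => (INR m + 1) * gauss_kernel m psi r + -2 * gauss_kernel (2 + m)
    phi r)
     (0 - gauss_kernel (S m) psi 0)).
  { apply is_improper_derive.
    - intros t.
      assert (D : forall p, is_derive (gauss_kernel p psi) t
        (INR p * t ^ pred p * exp (- (sqrt 3 / 2) * t ^ 2) * cos (psi - t ^ 2 / 2)
         - 2 * t * t ^ p * exp (- (sqrt 3 / 2) * t ^ 2) *
           (cos (PI / 6) * cos (psi - t ^ 2 / 2) - sin (PI / 6) * sin (psi - t ^ 2 / 2)))).
      { intros p; rewrite cos_PI6, sin_PI6; unfold gauss_kernel.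
        auto_derive; auto. simpl (t ^ 2). unfold Rminus, Rdiv; field. }
      evar_last; [apply D|].
      replace (cos (PI / 6) * cos (psi - t ^ 2 / 2) - sin (PI / 6) * sin (psi - t ^ 2 / 2))
        with (cos (phi - t ^ 2 / 2)).
      + unfold gauss_kernel; rewrite S_INR, (pow_add t 2 m); simpl Nat.pred; in_reals.
        change (t ^ S m) with (t * t ^ m); ring.
      + rewrite <- cos_plus; f_equal; unfold psi; ring.
    - unfold gauss_kernel; smooth.
    - apply dominated_lim0, dominated_kernel. }
  assert (H2 : is_improper (fun r => (INR m + 1) * gauss_kernel m psi r + -2 * gauss_kernel
    (2 + m) phi r)
    ((INR m + 1) * rotated_moment m psi + -2 * rotated_moment (2 + m) phi)).
  { apply is_improper_plus; try (unfold gauss_kernel; smooth; fail); apply is_improper_scal;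
      try (unfold gauss_kernel; smooth; fail);
    apply improper_correct, dominated_kernel. }
  assert (E := is_improper_unique _ _ _ H H2). unfold gauss_kernel at 1 in E.
  rewrite pow_i in E by lia; lra.
Qed.

Lemma cos_PI12_sqr : cos (PI / 12) ^ 2 - sin (PI / 12) ^ 2 = sqrt 3 / 2.
Proof.
  rewrite <- cos_PI6. replace (PI / 6) with (2 * (PI / 12)) by field.
  rewrite cos_2a; ring.
Qed.

Lemma sincos_PI12 : 2 * cos (PI / 12) * sin (PI / 12) = 1 / 2.
Proof.
  rewrite <- sin_PI6. replace (PI / 6) with (2 * (PI / 12)) by field.
  rewrite sin_2a; ring.
Qed.

Lemma PI12_pos : 0 < cos (PI / 12) /\ 0 < sin (PI / 12).
Proof.
  assert (P := PI_RGT_0); split.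
  - apply cos_gt_0; lra.
  - apply sin_gt_0; lra.
Qed.

(** By Cauchy's theorem the integral of exp(- s^2) along the ray of angle PI/12 equals
    the one along the real axis.  On the vertical segment that joins the two rays the
    integrand is largest on the slanted one, where it is a Gaussian. *)
Lemma gauss_rotated :
  is_improper (gauss_kernel 0 (PI / 12)) (sqrt PI / 2) /\
  is_improper (gauss_kernel 0 (PI / 12 - PI / 2)) 0.
Proof.
  destruct PI12_pos as [c0 s0].
  assert (E1 := cos_PI12_sqr). assert (E2 := sincos_PI12).
  set (c := cos (PI / 12)) in *; set (s := sin (PI / 12)) in *.
  destruct (exp_primitive (fun a b => b ^ 2 - a ^ 2) (fun a b => -2 * a * b)
    (fun a b => -2 * a) (fun a b => -2 * b)) as [P1 [P2 [HP1 HP2]]];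
    try (intros a b; auto_derive; auto; ring); try (intros a b; smooth2).
  assert (EX : forall t, (s * t) ^ 2 - (c * t) ^ 2 = - (sqrt 3 / 2) * t ^ 2).
  { intros t; rewrite <- E1; ring. }
  assert (HX : is_lim (fun t => P1 (c * t) 0) p_infty (sqrt PI / 2 + P1 0 0) /\
               is_lim (fun t => P2 (c * t) 0) p_infty (P2 0 0)).
  { assert (LC : is_lim (fun t => c * t) p_infty p_infty).
    { evar_last. apply (is_lim_scal_l (fun y => y) c p_infty p_infty), is_lim_id.
      simpl. destruct (Rle_dec 0 c) as [h|h]; [|exfalso; lra].
      destruct (Rle_lt_or_eq_dec 0 c h); [reflexivity|exfalso; lra]. }
    split.
    - apply (is_lim_comp (fun t => P1 t 0) (fun t => c * t) p_infty _ p_infty); auto.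
      2: exists 0; discriminate.
      apply (is_improper_primitive (fun t => P1 t 0) (fun t => exp (- t ^ 2))).
      + intros t. evar_last. apply (HP1 (fun t => t) (fun _ => 0) t 1 0); auto_derive; auto.
        simpl. replace (-2 * t * 0) with 0 by ring. rewrite cos_0, sin_0.
        replace (0 * (0 * 1) - t * (t * 1)) with (- (t * (t * 1))) by ring. in_reals; ring.
      + smooth.
      + apply gauss_half.
    - apply (is_lim_ext (fun _ => P2 0 0)); [|apply is_lim_const].
      intros t; symmetry. set (y := c * t).
      assert (B : Rabs (P2 y 0 - P2 0 0) <= Rabs (y - 0) * 0).
      { apply (derive_bounded_variation (fun t => P2 t 0) (fun _ => 0)).
        - intros u _. evar_last. apply (HP2 (fun t => t) (fun _ => 0) u 1 0); auto_derive; auto.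
          simpl. replace (-2 * u * 0) with 0 by ring. rewrite sin_0; in_reals; ring.
        - intros; rewrite Rabs_R0; lra. }
      rewrite Rmult_0_r in B. apply Rabs_le_between in B; lra. }
  assert (V : forall t u, 0 < t -> Rmin 0 (s * t) <= u <= Rmax 0 (s * t) ->
     exp (u ^ 2 - (c * t) ^ 2) <= exp (- (sqrt 3 / 2) * t ^ 2)).
  { intros t u Ht Hu. assert (0 < s * t) by nra.
    rewrite Rmin_left, Rmax_right in Hu by lra.
    rewrite <- EX. apply exp_le. nra. }
  assert (LV : is_lim (fun t => Rabs (s * t - 0) * exp (- (sqrt 3 / 2) * t ^ 2)) p_infty 0).
  { apply is_lim_ext_loc with (fun t => s * (t ^ 1 * exp (- (sqrt 3 / 2) * t ^ 2))).
    - exists 0; intros t Ht; rewrite Rabs_pos_eq by nra; ring.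
    - apply dominated_lim0, dominated_scal, dominated_gauss, sqrt3_half_pos. }
  assert (HV1 : is_lim (fun t => P1 (c * t) (s * t) - P1 (c * t) 0) p_infty 0).
  { apply (is_lim_squeeze0 _ _ 0) with (2 := LV). intros t Ht.
    apply (derive_bounded_variation (P1 (c * t)) (fun u => exp (u ^ 2 - (c * t) ^ 2) * - sin
      (-2 * (c * t) * u))).
    - intros u _. evar_last. apply (HP1 (fun _ => c * t) (fun u => u) u 0 1); auto_derive; auto.
      simpl; in_reals; ring.
    - intros u Hu. rewrite Rabs_mult, Rabs_Ropp, (Rabs_pos_eq (exp _)) by (left; apply exp_pos).
      specialize (V t u Ht Hu). generalize (Rabs_sin_le (-2 * (c * t) * u))
        (exp_pos (u ^ 2 - (c * t) ^ 2)); intros; nra. }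
  assert (HV2 : is_lim (fun t => P2 (c * t) (s * t) - P2 (c * t) 0) p_infty 0).
  { apply (is_lim_squeeze0 _ _ 0) with (2 := LV). intros t Ht.
    apply (derive_bounded_variation (P2 (c * t)) (fun u => exp (u ^ 2 - (c * t) ^ 2) * cos
      (-2 * (c * t) * u))).
    - intros u _. evar_last. apply (HP2 (fun _ => c * t) (fun u => u) u 0 1); auto_derive; auto.
      simpl; in_reals; ring.
    - intros u Hu. rewrite Rabs_mult, (Rabs_pos_eq (exp _)) by (left; apply exp_pos).
      specialize (V t u Ht Hu). generalize (Rabs_cos_le (-2 * (c * t) * u))
        (exp_pos (u ^ 2 - (c * t) ^ 2)); intros; nra. }
  assert (ER : forall t, -2 * (c * t) * (s * t) = - (t ^ 2 / 2)).
  { intros t; replace (-2 * (c * t) * (s * t)) with (- (2 * c * s) * t ^ 2) by ring; rewrite E2;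
      field. }
  destruct HX as [HX1 HX2]; split.
  - replace (sqrt PI / 2) with ((0 + (sqrt PI / 2 + P1 0 0)) - (fun t => P1 (c * t) (s * t)) 0).
    2: { cbv beta; rewrite !Rmult_0_r; ring. }
    apply (is_improper_derive (fun t => P1 (c * t) (s * t))).
    + intros t; evar_last. apply (HP1 (fun t => c * t) (fun t => s * t) t c s); auto_derive; auto;
        ring.
      cbv beta. rewrite EX, ER, cos_neg, sin_neg. unfold gauss_kernel. rewrite cos_minus. fold c s.
      simpl (t ^ 0); in_reals; ring.
    + apply dominated_kernel.
    + apply is_lim_ext with (fun t => (P1 (c * t) (s * t) - P1 (c * t) 0) + P1 (c * t) 0);
        [intros; ring|].
      now apply (is_lim_plus' _ _ p_infty 0 (sqrt PI / 2 + P1 0 0)).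
  - enough (H : is_improper (gauss_kernel 0 (PI / 12 - PI / 2))
        (P2 0 0 - (fun t => P2 (c * t) (s * t)) 0)).
    { cbv beta in H; rewrite !Rmult_0_r, Rminus_diag in H; exact H. }
    apply (is_improper_derive (fun t => P2 (c * t) (s * t))).
    + intros t; evar_last. apply (HP2 (fun t => c * t) (fun t => s * t) t c s); auto_derive; auto;
        ring.
      cbv beta. rewrite EX, ER, cos_neg, sin_neg. unfold gauss_kernel.
      replace (PI / 12 - PI / 2 - t ^ 2 / 2) with (- (PI / 2 - (PI / 12 - t ^ 2 / 2))) by ring.
      rewrite cos_neg, cos_shift, sin_minus. fold c s.
      simpl (t ^ 0); in_reals; ring.
    + apply dominated_kernel.
    + apply is_lim_ext with (fun t => (P2 (c * t) (s * t) - P2 (c * t) 0) + P2 (c * t) 0);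
        [intros; ring|].
      replace (Finite (P2 0 0)) with (Finite (0 + P2 0 0)) by (f_equal; ring).
      now apply (is_lim_plus' _ _ p_infty 0 (P2 0 0)).
Qed.

Lemma rotated_moment_0 phi : rotated_moment 0 phi = sqrt PI / 2 * cos (phi - PI / 12).
Proof.
  destruct gauss_rotated as [H1 H2]. apply is_improper_value.
  replace (sqrt PI / 2 * cos (phi - PI / 12)) with
    (cos (phi - PI / 12) * (sqrt PI / 2) + - sin (phi - PI / 12) * 0) by ring.
  apply is_improper_ext with (fun r => cos (phi - PI / 12) * gauss_kernel 0 (PI / 12) r
     + - sin (phi - PI / 12) * gauss_kernel 0 (PI / 12 - PI / 2) r).
  - intros t _; unfold gauss_kernel.
    replace (PI / 12 - PI / 2 - t ^ 2 / 2) with (- (PI / 2 - (PI / 12 - t ^ 2 / 2))) by ring.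
    rewrite cos_neg, cos_shift.
    replace (phi - t ^ 2 / 2) with ((phi - PI / 12) + (PI / 12 - t ^ 2 / 2)) by ring.
    rewrite cos_plus; ring.
  - apply is_improper_plus; try apply is_improper_scal; auto; unfold gauss_kernel; smooth.
Qed.

(** The product of the three factors (m+1)/2 that separate the moments of degree 6n and 6n+6. *)
Fixpoint moment_coef (n : nat) : R :=
  match n with
  | O => 1
  | S p => (6 * INR p + 1) * (6 * INR p + 3) * (6 * INR p + 5) / 8 * moment_coef p
  end.

(** Three steps of the recursion turn the phase by PI/2, that is multiply by - i. *)
Lemma rotated_moment_6 n phi :
  rotated_moment (6 * n) phi = moment_coef n * (sqrt PI / 2) * cos
    (phi - PI / 12 - INR n * (PI / 2)).
Proof.
  revert phi; induction n as [|n IH]; intros phi.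
  - simpl; rewrite rotated_moment_0, Rmult_0_l, Rminus_0_r; ring.
  - replace (6 * S n)%nat with (2 + (2 + (2 + 6 * n)))%nat by lia.
    rewrite !rotated_moment_rec, IH, !plus_INR, mult_INR.
    replace (INR 6) with 6 by (simpl; ring). replace (INR 2) with 2 by (simpl; ring).
    rewrite S_INR.
    replace (phi - PI / 6 - PI / 6 - PI / 6 - PI / 12 - INR n * (PI / 2))
      with (phi - PI / 12 - (INR n + 1) * (PI / 2)) by field.
    cbn [moment_coef]. field.
Qed.

(** Both sides have the ratio (6n+5)(6n+1) / (48(n+1)), the factor 6n+3 cancelling
    against the factorial; they agree at n = 0. *)
Lemma moment_coef_airy n :
  moment_coef n / (9 ^ n * INR (fact (2 * n))) = airy_coef n / (2 * PI).
Proof.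
  assert (P := PI_RGT_0).
  induction n as [|n IH].
  - rewrite airy_coef_0; simpl; field; lra.
  - rewrite airy_coef_rec.
    replace (2 * S n)%nat with (S (S (2 * n))) by lia.
    rewrite !fact_simpl, !mult_INR, !S_INR, mult_INR. replace (INR 2) with 2 by (simpl; ring).
    cbn [moment_coef].
    assert (0 <= INR n) by apply pos_INR. assert (F := INR_fact_neq_0 (2 * n)).
    assert (N9 : 9 ^ n <> 0) by (apply pow_nonzero; lra).
    change (9 ^ S n) with (9 * 9 ^ n).
    transitivity ((6 * INR n + 5) * (6 * INR n + 1) / (48 * (INR n + 1)) *
      (moment_coef n / (9 ^ n * INR (fact (2 * n))))).
    + field; repeat split; auto; lra.
    + rewrite IH; field; split; lra.
Qed.

(** * The Airy integrand and the contour through the saddle point *)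

(** Real part of i (s^3/3 + x s) at s = a + i b. *)
Definition log_modulus (x a b : R) : R := b ^ 3 / 3 - a ^ 2 * b - x * b.

(** Imaginary part of i (s^3/3 + x s) at s = a + i b. *)
Definition argument (x a b : R) : R := a ^ 3 / 3 - a * b ^ 2 + x * a.

(** Real part of the integral of exp(i (s^3/3 + x s)) along the contour that goes from
    - i oo to i eps on the imaginary axis and then to the right on Im s = eps.  The
    integrand is real on the imaginary axis while ds is imaginary there: only the
    horizontal half line contributes. *)
Definition contour_re (eps x : R) : R :=
  improper (fun t => exp (log_modulus x t eps) * cos (argument x t eps)).

(** Imaginary part of the same integral; the second term comes from the imaginary axis. *)
Definition contour_im (eps x : R) : R :=
  improper (fun t => exp (log_modulus x t eps) * sin (argument x t eps)) +
  improper (fun y => exp (log_modulus x 0 (eps - y))).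

Lemma dominated_exp_line m eps x : 0 < eps -> dominated (fun t => t ^ m * exp
  (log_modulus x t eps)).
Proof.
  intros He; unfold log_modulus.
  apply dominated_le with (fun t => exp (eps ^ 3 / 3 - x * eps) * (t ^ m * exp (- eps * t ^ 2))).
  - smooth.
  - apply dominated_scal, dominated_gauss, He.
  - intros t Ht. rewrite Rabs_pos_eq by (apply Rmult_le_pos;
      [now apply pow_le|left; apply exp_pos]).
    right.
    replace (eps ^ 3 / 3 - t ^ 2 * eps - x * eps) with ((eps ^ 3 / 3 - x * eps) + - eps * t ^ 2)
      by ring.
    rewrite exp_plus; ring.
Qed.

Lemma dominated_line eps x (g : R -> R) : 0 < eps ->
  (forall t, continuous g t) -> (forall t, 0 <= t -> Rabs (g t) <= 1) ->
  dominated (fun t => exp (log_modulus x t eps) * g t).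
Proof.
  intros He cg Hg; apply dominated_bounded_mult with 1; auto.
  apply dominated_le with (fun t => t ^ 0 * exp (log_modulus x t eps)).
  - unfold log_modulus; smooth.
  - now apply dominated_exp_line.
  - intros t _; rewrite (Rabs_pos_eq (exp _)) by (left; apply exp_pos); simpl; lra.
Qed.

Lemma dominated_cos_line eps x : 0 < eps -> dominated (fun t => exp (log_modulus x t eps) * cos
  (argument x t eps)).
Proof.
  intros He; apply dominated_line; auto; [unfold argument; smooth|intros; apply Rabs_cos_le].
Qed.

Lemma dominated_sin_line eps x : 0 < eps -> dominated (fun t => exp (log_modulus x t eps) * sin
  (argument x t eps)).
Proof.
  intros He; apply dominated_line; auto; [unfold argument; smooth|intros; apply Rabs_sin_le].
Qed.

Lemma dominated_exp_vertical eps x : 0 < eps -> dominated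
  (fun y => exp (log_modulus x 0 (eps - y))).
Proof.
  intros He; split; [unfold log_modulus; smooth|].
  (* With Y = y - eps, the cubic Y^3 is above its tangent at m for Y >= - 2 m; this m
     makes the slope of the tangent, 3 m^2, large enough and covers Y >= - eps. *)
  set (m := eps + Rabs x + 1). assert (Hx := Rle_abs x). assert (Hx' := Rabs_pos x).
  exists (exp (2 * m ^ 3 / 3 + (m ^ 2 - x) * eps)); intros y Hy.
  rewrite Rabs_pos_eq by (left; apply exp_pos).
  rewrite <- exp_plus; apply exp_le. unfold log_modulus.
  assert (Hm : m ^ 2 - x >= 1) by (unfold m; nra).
  assert (Hm' : m >= eps /\ m >= 1) by (unfold m; lra).
  assert (H : 0 <= ((y - eps) - m) ^ 2 * ((y - eps) + 2 * m)).
  { apply Rmult_le_pos; [apply pow2_ge_0|lra]. }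
  assert (H2 : 0 <= y * (m ^ 2 - x - 1)) by (apply Rmult_le_pos; lra).
  clearbody m. nra.
Qed.

Lemma Cexp_line eps x t :
  (let s := (RtoC t + Ci * RtoC eps)%C in
   Cexp (Ci * (s ^ 3 / RtoC 3 + RtoC x * s)))%C =
  (exp (log_modulus x t eps) * cos (argument x t eps), exp (log_modulus x t eps) * sin
    (argument x t eps)).
Proof.
  cbv zeta.
  assert (E : (Ci * ((RtoC t + Ci * RtoC eps) ^ 3 / RtoC 3 + RtoC x * (RtoC t + Ci * RtoC eps)))%C
     = (log_modulus x t eps, argument x t eps)).
  { unfold Cdiv. replace (/ RtoC 3)%C with (RtoC (/ 3)) by (rewrite RtoC_inv; auto; lra).
    unfold log_modulus, argument, RtoC, Ci, Cpow, Cmult, Cplus; simpl. f_equal; field. }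
  rewrite E. unfold Cexp, RtoC, Cmult; simpl. f_equal; ring.
Qed.

(** The real part of the integrand is even in t and its imaginary part odd, so the
    integral over the line is twice the real part of the integral over t > 0. *)
Lemma Airy_value eps x : 0 < eps -> Airy eps x = RtoC (contour_re eps x / PI).
Proof.
  intros He.
  set (e := fun t => exp (log_modulus x t eps) * cos (argument x t eps)).
  set (f := fun t => exp (log_modulus x t eps) * sin (argument x t eps)).
  assert (ce : forall t, continuous e t) by (unfold e, log_modulus, argument; smooth).
  assert (cf : forall t, continuous f t) by (unfold f, log_modulus, argument; smooth).
  assert (E1 : forall t, log_modulus x (- t) eps = log_modulus x t eps) by (intros;
    unfold log_modulus; ring).
  assert (E2 : forall t, argument x (- t) eps = - argument x t eps) by (intros; unfold argument;
    field).
  assert (ee : forall t, e (- t) = e t) by (intros; unfold e; now rewrite E1, E2, cos_neg).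
  assert (of : forall t, f (- t) = - f t) by (intros; unfold f; rewrite E1, E2, sin_neg; ring).
  assert (Le : is_improper e (contour_re eps x)) by (now apply improper_correct,
    dominated_cos_line).
  destruct (dominated_improper f) as [m Lf]; [now apply dominated_sin_line|].
  unfold Airy.
  match goal with |- Cmult _ ?I = _ => enough (E : I = ((2 * contour_re eps x, 0) : C)) end.
  - rewrite E. assert (P := PI_RGT_0). unfold RtoC, Cmult; simpl. f_equal; field; lra.
  - apply (is_RInt_gen_unique (V := C_R_CompleteNormedModule)); try apply _.
    apply (filterlimi_lim_ext_loc (fun ab => (RInt e 0 (snd ab) - RInt e 0 (fst ab), RInt f 0
      (snd ab) - RInt f 0 (fst ab)) : C)).
    + apply filter_forall; intros [a b]; simpl.
      apply (is_RInt_ext (V := C_R_NormedModule) (fun t => (e t, f t) : C)).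
      { intros t _; symmetry; apply Cexp_line. }
      apply (is_RInt_fct_extend_pair (U := R_NormedModule) (V := R_NormedModule)
        (fun t => (e t, f t))); simpl.
      * replace (RInt e 0 b - RInt e 0 a) with (RInt e a b).
        -- now apply (RInt_correct (V := R_CompleteNormedModule)), continuous_ex_RInt.
        -- now apply RInt_diff.
      * replace (RInt f 0 b - RInt f 0 a) with (RInt f a b).
        -- now apply (RInt_correct (V := R_CompleteNormedModule)), continuous_ex_RInt.
        -- now apply RInt_diff.
    + apply (filterlim_locally (U := C_R_NormedModule)). intros d.
      apply is_lim_spec in Le; apply is_lim_spec in Lf.
      assert (d2 : 0 < d / 2) by (destruct d; simpl; lra).
      destruct (Le (mkposreal _ d2)) as [M1 HM1]. destruct (Lf (mkposreal _ d2)) as [M2 HM2].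
      simpl in HM1, HM2. set (M := Rmax M1 M2).
      assert (B1 := Rmax_l M1 M2). assert (B2 := Rmax_r M1 M2). fold M in B1, B2.
      apply Filter_prod with (Q := fun a => a < - M) (R := fun b => M < b).
      * exists (- M); auto.
      * exists M; auto.
      * intros a b Ha Hb; simpl.
        assert (A1 := HM1 (- a) ltac:(lra)). assert (A2 := HM1 b ltac:(lra)).
        assert (A3 := HM2 (- a) ltac:(lra)). assert (A4 := HM2 b ltac:(lra)).
        assert (Ra := RInt_even e (- a) ce ee).
        assert (Rf := RInt_odd f (- a) cf of).
        rewrite Ropp_involutive in Ra, Rf.
        rewrite Ra, Rf.
        apply Rabs_lt_between in A1; apply Rabs_lt_between in A2; apply Rabs_lt_between in A3;
          apply Rabs_lt_between in A4.
        split; simpl; unfold ball; simpl; unfold AbsRing_ball, abs, minus, plus, opp; simpl;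
          apply Rabs_lt_between; lra.
Qed.

Lemma is_lim_affine_pinf (c d : R) : 0 < c -> is_lim (fun t => c * t + d) p_infty p_infty.
Proof.
  intros Hc. evar_last.
  - apply (is_lim_plus (fun t => c * t) (fun _ => d) p_infty p_infty d p_infty).
    + evar_last. apply (is_lim_scal_l (fun y => y) c p_infty p_infty), is_lim_id.
      simpl. destruct (Rle_dec 0 c) as [h|h]; [|exfalso; lra].
      destruct (Rle_lt_or_eq_dec 0 c h); [reflexivity|exfalso; lra].
    + apply is_lim_const.
    + reflexivity.
  - reflexivity.
Qed.

Lemma is_lim_comp_affine (f : R -> R) (c d l : R) : 0 < c ->
  is_lim f p_infty l -> is_lim (fun t => f (c * t + d)) p_infty l.
Proof.
  intros Hc Hf; apply (is_lim_comp f (fun t => c * t + d) p_infty l p_infty); auto.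
  - now apply is_lim_affine_pinf.
  - exists 0; discriminate.
Qed.

Lemma is_lim_linear_exp c : 0 < c -> is_lim (fun t => t * exp (- c * t)) p_infty 0.
Proof.
  intros Hc.
  apply is_lim_le_le_loc with (f := fun _ => 0) (g := fun t => 2 / c ^ 2 * / t).
  - exists 0; intros t Ht.
    assert (E := pow_le_fact_exp 2 (c * t)). simpl (INR (fact 2)) in E.
    assert (Hct : 0 < c * t) by nra.
    replace (- c * t) with (- (c * t)) by ring. rewrite exp_Ropp.
    assert (P := exp_pos (c * t)). assert (E' : (c * t) ^ 2 <= 2 * exp (c * t)) by (apply E; lra).
    split.
    + apply Rmult_le_pos; [lra|left; now apply Rinv_0_lt_compat].
    + apply Rmult_le_reg_r with (exp (c * t) * (c ^ 2 * t)).
      * apply Rmult_lt_0_compat; auto. apply Rmult_lt_0_compat; auto. now apply pow_lt.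
      * replace (t * / exp (c * t) * (exp (c * t) * (c ^ 2 * t))) with ((c * t) ^ 2) by (field;
          lra).
        replace (2 / c ^ 2 * / t * (exp (c * t) * (c ^ 2 * t))) with (2 * exp (c * t)) by (field;
          lra).
        exact E'.
  - apply is_lim_const.
  - replace (Finite 0) with (Rbar_mult (2 / c ^ 2) 0) by (simpl; f_equal; ring).
    apply is_lim_scal_l. apply (is_lim_inv (fun t => t) p_infty p_infty);
      [apply is_lim_id|discriminate].
Qed.

(** The integrand on the line through the saddle point, after folding r and - r: the
    cubic part of the exponent, odd in r, leaves a cosine. *)
Definition saddle_kernel (phi w r : R) : R :=
  exp (- (sqrt 3 / 2) * r ^ 2) * cos (phi - r ^ 2 / 2) * cos (r ^ 3 / (3 * w ^ 3)).

Section Contour.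

Variables (eps v : R).
Hypotheses (Heps : 0 < eps) (Hv : 0 < v).
Let x := - v ^ 4.
Let k := sqrt 3 / 2.
Let line_re := fun r => v ^ 2 + r / (2 * v).
Let line_im := fun r => k * r / v.

Lemma half_sqrt3_sqr : k ^ 2 = 3 / 4.
Proof.
  unfold k. replace ((sqrt 3 / 2) ^ 2) with (sqrt 3 * sqrt 3 / 4) by field.
  rewrite sqrt_sqrt; lra.
Qed.

(** On this line the cubic term is purely oscillating and the quadratic one damps. *)
Lemma log_modulus_line r : log_modulus x (line_re r) (line_im r) = - k * r ^ 2.
Proof.
  unfold log_modulus, line_re, line_im, x.
  transitivity (k * k ^ 2 * r ^ 3 / v ^ 3 / 3 - k * r ^ 2 - k * r ^ 3 / (4 * v ^ 3)).
  - field; lra.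
  - rewrite half_sqrt3_sqr; field; lra.
Qed.

Lemma argument_line r :
  argument x (line_re r) (line_im r) = - (2 / 3) * v ^ 6 - r ^ 2 / 2 - r ^ 3 / (3 * v ^ 3).
Proof.
  unfold argument, line_re, line_im, x.
  transitivity ((v ^ 2 + r / (2 * v)) ^ 3 / 3 - (v ^ 2 + r / (2 * v)) * (k ^ 2) * r ^ 2 / v ^ 2
    - v ^ 4 * (v ^ 2 + r / (2 * v))).
  - field; lra.
  - rewrite half_sqrt3_sqr; field; lra.
Qed.

(** Between the line Im s = eps and the slanted line, b^2/3 is at most (a - v^2)^2,
    whence a^2 - b^2/3 - v^4 >= v r. *)
Lemma log_modulus_upper r t : 0 < r -> eps <= t <= line_im r ->
  log_modulus x (line_re r) t <= - (eps * v) * r.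
Proof.
  intros Hr [H1 H2]. unfold log_modulus, x.
  assert (Ht : t ^ 2 / 3 <= (r / (2 * v)) ^ 2).
  { assert (t ^ 2 <= (line_im r) ^ 2) by (apply pow_incr; lra).
    assert (E : line_im r ^ 2 = 3 * (r / (2 * v)) ^ 2).
    { unfold line_im. replace ((k * r / v) ^ 2) with (k ^ 2 * r ^ 2 / v ^ 2) by (field; lra).
      rewrite half_sqrt3_sqr; field; lra. }
    lra. }
  assert (E : line_re r ^ 2 - (r / (2 * v)) ^ 2 - v ^ 4 = v * r) by (unfold line_re; field; lra).
  assert (0 < v * r) by nra.
  replace (t ^ 3 / 3 - line_re r ^ 2 * t - - v ^ 4 * t) with
    (- t * (line_re r ^ 2 - t ^ 2 / 3 - v ^ 4)) by field.
  assert (v * r <= line_re r ^ 2 - t ^ 2 / 3 - v ^ 4) by lra.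
  nra.
Qed.

(** The same comparison below the real axis, between the slanted line and the imaginary axis. *)
Lemma log_modulus_lower r t : 0 < r -> line_re (- r) <= t <= 0 ->
  log_modulus x t (line_im (- r)) <= - k * r ^ 2.
Proof.
  intros Hr [H1 H2]. unfold log_modulus, x.
  assert (Hk : 0 < k) by apply sqrt3_half_pos.
  set (B := k * r / v). assert (HB : 0 < B) by (unfold B; apply Rmult_lt_0_compat;
    [nra|now apply Rinv_0_lt_compat]).
  replace (line_im (- r)) with (- B) by (unfold line_im, B; field; lra).
  assert (Ht : t ^ 2 <= line_re (- r) ^ 2) by nra.
  assert (EB : B ^ 2 / 3 = (r / (2 * v)) ^ 2).
  { unfold B. replace ((k * r / v) ^ 2) with (k ^ 2 * r ^ 2 / v ^ 2) by (field; lra).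
    rewrite half_sqrt3_sqr; field; lra. }
  assert (E : line_re (- r) ^ 2 - (r / (2 * v)) ^ 2 - v ^ 4 = - (v * r)) by (unfold line_re;
    field; lra).
  replace ((- B) ^ 3 / 3 - t ^ 2 * - B - - v ^ 4 * - B) with (B * (t ^ 2 - B ^ 2 / 3 - v ^ 4))
    by field.
  assert (t ^ 2 - B ^ 2 / 3 - v ^ 4 <= - (v * r)) by lra.
  replace (- k * r ^ 2) with (B * - (v * r)) by (unfold B; field; lra).
  apply Rmult_le_compat_l; lra.
Qed.

(** Far out, the vertical segment from the line Im s = eps to the slanted line
    contributes nothing, so a primitive has the same limit along both. *)
Lemma upper_end (P p q : R -> R -> R) (L : R) :
  (forall (al be : R -> R) t al' be', is_derive al t al' -> is_derive be t be' ->
    is_derive (fun t => P (al t) (be t)) t (exp (log_modulus x (al t) (be t)) *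
      (p (al t) (be t) * al' + q (al t) (be t) * be'))) ->
  (forall a b, Rabs (q a b) <= 1) ->
  is_lim (fun t => P t eps) p_infty L -> is_lim (fun r => P (line_re r) (line_im r)) p_infty L.
Proof.
  intros HP Hq HL.
  assert (Hk : 0 < k) by apply sqrt3_half_pos.
  assert (Hkv : 0 < k / v) by (apply Rmult_lt_0_compat; auto; now apply Rinv_0_lt_compat).
  apply is_lim_ext with (fun r => (P (line_re r) (line_im r) - P (line_re r) eps) + P
    (/ (2 * v) * r + v ^ 2) eps).
  { intros r; replace (/ (2 * v) * r + v ^ 2) with (line_re r) by (unfold line_re; field; lra);
      ring. }
  replace (Finite L) with (Finite (0 + L)) by (f_equal; ring).
  apply (is_lim_plus' _ _ p_infty 0 L).
  2: { apply (is_lim_comp_affine (fun t => P t eps)); auto. apply Rinv_0_lt_compat; lra. }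
  (* For r beyond eps v / k the slanted line is above the line Im s = eps. *)
  apply (is_lim_squeeze0 _ (fun r => (k / v) * (r * exp (- (eps * v) * r))) (Rmax 0 (eps * v / k))).
  - intros r Hr.
    assert (R0 : 0 < r) by (apply Rle_lt_trans with (2 := Hr); apply Rmax_l).
    assert (Hb : eps <= line_im r).
    { assert (R1 : eps * v / k < r) by (apply Rle_lt_trans with (2 := Hr); apply Rmax_r).
      unfold line_im. replace eps with (k / v * (eps * v / k)) by (field; lra).
      replace (k * r / v) with (k / v * r) by (field; lra).
      apply Rmult_le_compat_l; lra. }
    apply Rle_trans with (Rabs (line_im r - eps) * exp (- (eps * v) * r)).
    + apply (derive_bounded_variation (P (line_re r)) (fun u => exp (log_modulus x (line_re r) u)
        * q (line_re r) u)).
      * intros u _. evar_last. apply (HP (fun _ => line_re r) (fun u => u) u 0 1); auto_derive;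
          auto.
        in_reals; ring.
      * intros u Hu. rewrite Rmin_left, Rmax_right in Hu by lra.
        assert (B := exp_le _ _ (log_modulus_upper r u R0 Hu)).
        rewrite Rabs_mult, (Rabs_pos_eq (exp _)) by (left; apply exp_pos).
        generalize (exp_pos (log_modulus x (line_re r) u)) (Hq (line_re r) u); intros; nra.
    + rewrite <- Rmult_assoc; apply Rmult_le_compat_r; [left; apply exp_pos|].
      rewrite Rabs_pos_eq by lra. unfold line_im in *. replace (k / v * r) with (k * r / v)
        by (field; lra). lra.
  - replace (Finite 0) with (Rbar_mult (k / v) 0) by (simpl; f_equal; ring).
    apply is_lim_scal_l, is_lim_linear_exp; nra.
Qed.

(** The analogue at the other end, with horizontal segments from the slanted line to
    the imaginary axis. *)
Lemma lower_end (P p q : R -> R -> R) (L : R) :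
  (forall (al be : R -> R) t al' be', is_derive al t al' -> is_derive be t be' ->
    is_derive (fun t => P (al t) (be t)) t (exp (log_modulus x (al t) (be t)) *
      (p (al t) (be t) * al' + q (al t) (be t) * be'))) ->
  (forall a b, Rabs (p a b) <= 1) ->
  is_lim (fun t => P 0 (eps - t)) p_infty L -> is_lim (fun r => P (line_re (- r)) (line_im (- r)))
    p_infty L.
Proof.
  intros HP Hp HL.
  assert (Hk : 0 < k) by apply sqrt3_half_pos.
  assert (Hkv : 0 < k / v) by (apply Rmult_lt_0_compat; auto; now apply Rinv_0_lt_compat).
  assert (Hi : 0 < / (2 * v)) by (apply Rinv_0_lt_compat; lra).
  apply is_lim_ext with (fun r => (P (line_re (- r)) (line_im (- r)) - P 0 (line_im (- r))) + P 0
    (eps - (k / v * r + eps))).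
  { intros r; replace (eps - (k / v * r + eps)) with (line_im (- r)) by (unfold line_im; field;
      lra); ring. }
  replace (Finite L) with (Finite (0 + L)) by (f_equal; ring).
  apply (is_lim_plus' _ _ p_infty 0 L).
  2: { apply (is_lim_comp_affine (fun t => P 0 (eps - t))); auto. }
  (* For r > 2 v^3 the slanted line is to the left of the imaginary axis. *)
  apply (is_lim_squeeze0 _ (fun r => / (2 * v) * (r ^ 1 * exp (- k * r ^ 2))) (2 * v ^ 3)).
  - intros r Hr. assert (V3 : 0 < v ^ 3) by now apply pow_lt.
    assert (Ha : line_re (- r) <= 0).
    { unfold line_re. replace (v ^ 2 + - r / (2 * v)) with (/ (2 * v) * (2 * v ^ 3 - r))
        by (field; lra). nra. }
    rewrite <- Rabs_Ropp.
    replace (- (P (line_re (- r)) (line_im (- r)) - P 0 (line_im (- r)))) with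
      (P 0 (line_im (- r)) - P (line_re (- r)) (line_im (- r))) by ring.
    apply Rle_trans with (Rabs (0 - line_re (- r)) * exp (- k * r ^ 2)).
    + apply (derive_bounded_variation (fun u => P u (line_im (- r)))
        (fun u => exp (log_modulus x u (line_im (- r))) * p u (line_im (- r)))).
      * intros u _. evar_last. apply (HP (fun u => u) (fun _ => line_im (- r)) u 1 0);
          auto_derive; auto.
        in_reals; ring.
      * intros u Hu. rewrite Rmin_left, Rmax_right in Hu by lra.
        assert (R0 : 0 < r) by lra.
        assert (B := exp_le _ _ (log_modulus_lower r u R0 Hu)).
        rewrite Rabs_mult, (Rabs_pos_eq (exp _)) by (left; apply exp_pos).
        generalize (exp_pos (log_modulus x u (line_im (- r)))) (Hp u (line_im (- r))); intros; nra.
    + rewrite <- Rmult_assoc; apply Rmult_le_compat_r; [left; apply exp_pos|].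
      rewrite Rabs_pos_eq by lra. unfold line_re in *.
      replace (0 - (v ^ 2 + - r / (2 * v))) with (/ (2 * v) * r ^ 1 - v ^ 2) by (field; lra).
      assert (0 <= v ^ 2) by apply pow2_ge_0; lra.
  - apply dominated_lim0, dominated_scal, dominated_gauss, sqrt3_half_pos.
Qed.

(** A primitive of the integrand has the same limits at the two ends of the slanted
    line as at the two ends of the contour that defines contour_re and contour_im.
    The direction e^(i PI/3) of the line adds PI/3 to the phase. *)
Lemma contour_shift :
  is_improper (fun r => 2 / v * saddle_kernel (PI / 3 - 2 / 3 * v ^ 6) v r) (contour_re eps x) /\
  is_improper (fun r => 2 / v * saddle_kernel (PI / 3 - 2 / 3 * v ^ 6 - PI / 2) v r)
    (contour_im eps x).
Proof.
  destruct (exp_primitive (log_modulus x) (argument x) (fun a b => -2 * a * b)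
    (fun a b => a ^ 2 - b ^ 2 + x)) as [P1 [P2 [HP1 HP2]]];
    try (intros a b; unfold log_modulus, argument; auto_derive; auto; field);
      try (intros a b; unfold log_modulus, argument, Rdiv; smooth2).
  (* Upper and lower ends, for the real and the imaginary part of the primitive. *)
  assert (U1 := upper_end P1 (fun a b => cos (argument x a b)) (fun a b => - sin (argument x a b))
    (contour_re eps x + P1 0 eps) HP1
     (fun a b => eq_ind_r (fun z => z <= 1) (Rabs_sin_le _) (Rabs_Ropp _))).
  assert (U2 := upper_end P2 (fun a b => sin (argument x a b)) (fun a b => cos (argument x a b))
    (improper (fun t => exp (log_modulus x t eps) * sin (argument x t eps)) + P2 0 eps) HP2
     (fun a b => Rabs_cos_le _)).
  assert (L1 := lower_end P1 (fun a b => cos (argument x a b)) (fun a b => - sin (argument x a b))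
    (P1 0 eps) HP1 (fun a b => Rabs_cos_le _)).
  assert (L2 := lower_end P2 (fun a b => sin (argument x a b)) (fun a b => cos (argument x a b))
    (- 1 * improper (fun y => exp (log_modulus x 0 (eps - y))) + P2 0 eps) HP2
      (fun a b => Rabs_sin_le _)).
  assert (Z : forall b, argument x 0 b = 0) by (intros; unfold argument; field).
  assert (K1 : is_lim (fun r => P1 (line_re r) (line_im r)) p_infty (contour_re eps x + P1 0 eps)).
  { apply U1. apply (is_improper_primitive (fun t => P1 t eps)
      (fun t => exp (log_modulus x t eps) * cos (argument x t eps))).
    - intros t. evar_last. apply (HP1 (fun t => t) (fun _ => eps) t 1 0); auto_derive;
        auto. in_reals; ring.
    - unfold log_modulus, argument; smooth.
    - now apply improper_correct, dominated_cos_line. }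
  assert (K2 : is_lim (fun r => P2 (line_re r) (line_im r)) p_infty
    (improper (fun t => exp (log_modulus x t eps) * sin (argument x t eps)) + P2 0 eps)).
  { apply U2. apply (is_improper_primitive (fun t => P2 t eps)
      (fun t => exp (log_modulus x t eps) * sin (argument x t eps))).
    - intros t. evar_last. apply (HP2 (fun t => t) (fun _ => eps) t 1 0); auto_derive;
        auto. in_reals; ring.
    - unfold log_modulus, argument; smooth.
    - now apply improper_correct, dominated_sin_line. }
  assert (M1 : is_lim (fun r => P1 (line_re (- r)) (line_im (- r))) p_infty (P1 0 eps)).
  { apply L1. apply is_lim_ext with (fun _ => P1 0 eps); [|apply is_lim_const].
    intros t.
    assert (B : Rabs (P1 0 (eps - t) - P1 0 eps) <= Rabs (eps - t - eps) * 0).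
    { apply (derive_bounded_variation (P1 0) (fun _ => 0)).
      - intros u _. evar_last. apply (HP1 (fun _ => 0) (fun u => u) u 0 1); auto_derive; auto.
        rewrite Z, sin_0; in_reals; ring.
      - intros; rewrite Rabs_R0; lra. }
    rewrite Rmult_0_r in B. apply Rabs_le_between in B; lra. }
  assert (M2 : is_lim (fun r => P2 (line_re (- r)) (line_im (- r))) p_infty
    (- 1 * improper (fun y => exp (log_modulus x 0 (eps - y))) + P2 0 eps)).
  { apply L2. replace (P2 0 eps) with (P2 0 (eps - 0)) by (f_equal; ring).
    apply (is_improper_primitive (fun t => P2 0 (eps - t))
      (fun t => -1 * exp (log_modulus x 0 (eps - t)))).
    - intros t. evar_last. apply (HP2 (fun _ => 0) (fun t => eps - t) t 0 (-1)); auto_derive; auto.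
      rewrite Z, cos_0; in_reals; ring.
    - unfold log_modulus; smooth.
    - apply is_improper_scal; [unfold log_modulus; smooth|]. now apply improper_correct,
        dominated_exp_vertical. }
  assert (Cs : forall A B, cos (A - B) + cos (A + B) = 2 * cos A * cos B).
  { intros; rewrite cos_minus, cos_plus; ring. }
  assert (Sn : forall A B, sin (A - B) + sin (A + B) = 2 * sin A * cos B).
  { intros; rewrite sin_minus, sin_plus; ring. }
  assert (Dla : forall t, is_derive line_re t (/ (2 * v))).
  { intros t; unfold line_re; auto_derive; auto; field; lra. }
  assert (Dlb : forall t, is_derive line_im t (k / v)).
  { intros t; unfold line_im; auto_derive; auto; field; lra. }
  assert (Dla' : forall t, is_derive (fun t => line_re (- t)) t (- / (2 * v))).
  { intros t; unfold line_re; auto_derive; auto; field; lra. }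
  assert (Dlb' : forall t, is_derive (fun t => line_im (- t)) t (- (k / v))).
  { intros t; unfold line_im; auto_derive; auto; field; lra. }
  assert (cker : forall phi r, continuous (fun r => 2 / v * saddle_kernel phi v r) r).
  { unfold saddle_kernel; smooth. }
  (* Even and odd parts in r of the phase along the line, the factor e^(i PI/3) of ds
     included; adding the contributions of r and - r leaves 2 cos (B r). *)
  set (A := fun r => PI / 3 - 2 / 3 * v ^ 6 - r ^ 2 / 2).
  set (B := fun r => r ^ 3 / (3 * v ^ 3)).
  assert (EG : forall r, argument x (line_re r) (line_im r) = A r - B r - PI / 3).
  { intros r; rewrite argument_line; unfold A, B; field; lra. }
  assert (EA : forall r, A (- r) = A r) by (intros; unfold A; field).
  assert (EB : forall r, B (- r) = - B r) by (intros; unfold B; field; lra).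
  assert (C3 : cos (PI / 3) = 1 / 2) by apply cos_PI3.
  assert (S3 : sin (PI / 3) = k) by apply sin_PI3.
  assert (c3 : forall t, cos (t - PI / 3) * / (2 * v) - sin (t - PI / 3) * (k / v) = cos t / v).
  { intros t. replace (cos t) with (cos ((t - PI / 3) + PI / 3)) by (f_equal; ring).
    rewrite cos_plus, C3, S3; field; lra. }
  assert (s3 : forall t, sin (t - PI / 3) * / (2 * v) + cos (t - PI / 3) * (k / v) = sin t / v).
  { intros t. replace (sin t) with (sin ((t - PI / 3) + PI / 3)) by (f_equal; ring).
    rewrite sin_plus, C3, S3; field; lra. }
  assert (EN : forall t, - k * (- t) ^ 2 = - k * t ^ 2) by (intros; ring).
  split.
  - enough (H : is_improper (fun r => 2 / v * saddle_kernel (PI / 3 - 2 / 3 * v ^ 6) v r)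
      ((contour_re eps x + P1 0 eps - P1 0 eps) - (fun r => P1 (line_re r) (line_im r) - P1
        (line_re (- r)) (line_im (- r))) 0)).
    { cbv beta in H; rewrite Ropp_0 in H.
      match type of H with is_improper _ ?l => replace l with (contour_re eps x) in H by ring end;
        exact H. }
    apply (is_improper_derive (fun r => P1 (line_re r) (line_im r) - P1 (line_re (- r))
      (line_im (- r)))); auto.
    + intros t. evar_last.
      * apply (is_derive_minus (V := R_NormedModule) (fun r => P1 (line_re r) (line_im r))
          (fun r => P1 (line_re (- r)) (line_im (- r)))).
        -- apply (HP1 line_re line_im t _ _ (Dla t) (Dlb t)).
        -- apply (HP1 (fun t => line_re (- t)) (fun t => line_im (- t)) t _ _ (Dla' t) (Dlb' t)).
      * cbv beta. unfold minus, plus, opp; cbn -[pow]. rewrite !log_modulus_line, !EG, EA, EB, EN.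
        transitivity (exp (- k * t ^ 2) * (cos (A t - B t) / v + cos (A t - - B t) / v)).
        -- rewrite <- !c3; in_reals; ring.
        -- replace (A t - - B t) with (A t + B t) by ring.
           replace (cos (A t - B t) / v + cos (A t + B t) / v) with
             ((cos (A t - B t) + cos (A t + B t)) / v) by (field; lra).
           rewrite Cs; unfold saddle_kernel; fold k; fold (A t) (B t); in_reals; field; lra.
    + apply (is_lim_minus' _ _ p_infty (contour_re eps x + P1 0 eps) (P1 0 eps)); auto.
  - enough (H : is_improper (fun r => 2 / v * saddle_kernel (PI / 3 - 2 / 3 * v ^ 6 - PI / 2) v r)
     ((improper (fun t => exp (log_modulus x t eps) * sin (argument x t eps)) + P2 0 eps
       - (- 1 * improper (fun y => exp (log_modulus x 0 (eps - y))) + P2 0 eps))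
           - (fun r => P2 (line_re r) (line_im r) - P2 (line_re (- r)) (line_im (- r))) 0)).
    { cbv beta in H; rewrite Ropp_0 in H.
      match type of H with is_improper _ ?l => replace l with (contour_im eps x) in H
        by (unfold contour_im; ring) end; exact H. }
    apply (is_improper_derive (fun r => P2 (line_re r) (line_im r) - P2 (line_re (- r))
      (line_im (- r)))); auto.
    + intros t. evar_last.
      * apply (is_derive_minus (V := R_NormedModule) (fun r => P2 (line_re r) (line_im r))
          (fun r => P2 (line_re (- r)) (line_im (- r)))).
        -- apply (HP2 line_re line_im t _ _ (Dla t) (Dlb t)).
        -- apply (HP2 (fun t => line_re (- t)) (fun t => line_im (- t)) t _ _ (Dla' t) (Dlb' t)).
      * cbv beta. unfold minus, plus, opp; cbn -[pow]. rewrite !log_modulus_line, !EG, EA, EB, EN.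
        transitivity (exp (- k * t ^ 2) * (sin (A t - B t) / v + sin (A t - - B t) / v)).
        -- rewrite <- !s3; in_reals; ring.
        -- replace (A t - - B t) with (A t + B t) by ring.
           replace (sin (A t - B t) / v + sin (A t + B t) / v) with
             ((sin (A t - B t) + sin (A t + B t)) / v) by (field; lra).
           rewrite Sn; unfold saddle_kernel; fold k.
           replace (PI / 3 - 2 / 3 * v ^ 6 - PI / 2 - t ^ 2 / 2) with (- (PI / 2 - A t))
             by (unfold A; ring).
           rewrite cos_neg, cos_shift; fold (B t); in_reals; field; lra.
    + apply (is_lim_minus' _ _ p_infty (improper (fun t => exp (log_modulus x t eps) * sin
        (argument x t eps)) + P2 0 eps)); auto.
Qed.

End Contour.

(** * Taylor expansion under the saddle point integral *)

(** Taylor's formula with the Lagrange remainder, on both sides of 0; the family [d]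
    lists the successive derivatives. *)
Lemma taylor_bound (d : nat -> R -> R) (B y : R) (n : nat) :
  (forall k t, is_derive (d k) t (d (S k) t)) ->
  (forall t, Rabs t <= Rabs y -> Rabs (d (S n) t) <= B) ->
  Rabs (d 0%nat y - sum_f_R0 (fun k => y ^ k / INR (fact k) * d k 0) n) <=
  Rabs y ^ S n / INR (fact (S n)) * B.
Proof.
  intros Hd HB.
  destruct (Req_dec y 0) as [->|Hy].
  - rewrite Rabs_R0, pow_i by lia.
    replace (sum_f_R0 _ n) with (d 0%nat 0).
    + rewrite Rminus_diag, Rabs_R0; unfold Rdiv; lra.
    + symmetry; clear HB; induction n as [|n IH].
      * simpl; field.
      * rewrite tech5, IH, pow_i by lia; unfold Rdiv; ring.
  - set (s := sign y). 
    assert (Hs : Rabs s = 1 /\ y = s * Rabs y).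
    { unfold s; destruct (Rle_lt_dec 0 y).
      - rewrite sign_eq_1 by lra. rewrite Rabs_R1, Rabs_pos_eq by lra; lra.
      - rewrite sign_eq_m1 by lra. rewrite Rabs_left by lra; rewrite Rabs_left by lra; lra. }
    destruct Hs as [Hs1 Hs2].
    (* The derivatives of t -> f (s t), s the sign of y, reduce the claim to y > 0. *)
    set (e := fun k t => s ^ k * d k (s * t)).
    assert (He : forall k t, is_derive (e k) t (e (S k) t)).
    { intros k t; unfold e; evar_last.
      - apply (is_derive_scal (fun t => d k (s * t))).
        apply (is_derive_comp (V := R_NormedModule) (d k) (fun t => s * t)); [apply Hd|].
        auto_derive; auto.
      - unfold scal; simpl; unfold mult; simpl; in_reals; ring. }
    assert (HD : forall k t, Derive_n (e 0%nat) k t = e k t).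
    { induction k as [|k IH]; intros t; [reflexivity|].
      simpl. rewrite (Derive_ext _ (e k)) by auto. apply is_derive_unique, He. }
    assert (Hpos : 0 < Rabs y) by now apply Rabs_pos_lt.
    destruct (Taylor_Lagrange (e 0%nat) n 0 (Rabs y) Hpos) as [z [Hz E]].
    { intros t _ [|k] _; simpl; auto. exists (e (S k) t).
      apply is_derive_ext with (e k); auto. }
    assert (E0 : e 0%nat (Rabs y) = d 0%nat y) by (unfold e; rewrite <- Hs2; simpl; ring).
    rewrite E0 in E. rewrite E, HD.
    rewrite (sum_eq _ (fun k => y ^ k / INR (fact k) * d k 0)).
    + replace (_ + _ - _) with ((Rabs y - 0) ^ S n / INR (fact (S n)) * e (S n) z) by ring.
      rewrite Rminus_0_r, Rabs_mult. unfold Rdiv; rewrite Rabs_mult.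
      rewrite (Rabs_pos_eq (Rabs y ^ S n)) by (apply pow_le, Rabs_pos).
      rewrite (Rabs_pos_eq (/ _)) by (left; apply Rinv_0_lt_compat, INR_fact_lt_0).
      apply Rmult_le_compat_l.
      * apply Rmult_le_pos; [apply pow_le, Rabs_pos|left; apply Rinv_0_lt_compat, INR_fact_lt_0].
      * unfold e. rewrite Rabs_mult, <- RPow_abs, Hs1, pow1, Rmult_1_l. apply HB.
        rewrite Rabs_mult, Hs1, Rmult_1_l, Rabs_pos_eq; lra.
    + intros k _. rewrite HD, Rminus_0_r; unfold e. rewrite Rmult_0_r.
      rewrite Hs2 at 2. rewrite Rpow_mult_distr; unfold Rdiv; ring.
Qed.

Lemma cos_taylor_bound th y n :
  Rabs (cos (th + y) - sum_f_R0 (fun k => y ^ k / INR (fact k) * cos (th + INR k * (PI / 2))) n) <=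
  Rabs y ^ S n / INR (fact (S n)).
Proof.
  assert (H := taylor_bound (fun k t => cos (th + t + INR k * (PI / 2))) 1 y n).
  rewrite Rmult_1_r in H.
  eapply Rle_trans; [|apply H].
  - right; f_equal; f_equal; [f_equal; simpl; ring|].
    apply sum_eq; intros k _; do 2 f_equal; ring.
  - intros k t; evar_last; [auto_derive; auto|]; cbv beta.
    rewrite S_INR.
    replace (th + t + (INR k + 1) * (PI / 2)) with (PI / 2 + (th + t + INR k * (PI / 2))) by ring.
    rewrite <- (Ropp_involutive (cos (PI / 2 + _))), <- sin_cos; in_reals; ring.
  - intros; apply Rabs_cos_le.
Qed.

Lemma exp_taylor_bound y n :
  Rabs (exp y - sum_f_R0 (fun k => y ^ k / INR (fact k)) n) <=
  Rabs y ^ S n / INR (fact (S n)) * exp (Rabs y).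
Proof.
  assert (H := taylor_bound (fun k t => exp t) (exp (Rabs y)) y n).
  eapply Rle_trans; [|apply H].
  - right; f_equal; f_equal.
    apply sum_eq; intros k _; rewrite exp_0; ring.
  - intros k t; apply is_derive_exp.
  - intros t Ht; rewrite Rabs_pos_eq by (left; apply exp_pos). apply exp_le.
    generalize (Rle_abs t); lra.
Qed.

Lemma cos_nPI n : cos (INR n * PI) = (-1) ^ n.
Proof.
  induction n as [|n IH]; [simpl; rewrite Rmult_0_l; apply cos_0|].
  rewrite S_INR, Rmult_plus_distr_r, Rmult_1_l, neg_cos, IH; simpl; ring.
Qed.

Lemma cos_even_PI2 n : cos (INR (2 * n) * (PI / 2)) = (-1) ^ n.
Proof. rewrite <- cos_nPI; f_equal; rewrite mult_INR; simpl; field. Qed.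

Lemma cos_odd_PI2 n : cos (INR (2 * n + 1) * (PI / 2)) = 0.
Proof.
  rewrite plus_INR, mult_INR.
  replace ((INR 2 * INR n + INR 1) * (PI / 2)) with (PI / 2 + INR n * PI) by (simpl; field).
  rewrite cos_plus, cos_PI2.
  assert (S : sin (INR n * PI) = 0).
  { clear. induction n as [|n IH]; [simpl; rewrite Rmult_0_l; apply sin_0|].
    rewrite S_INR, Rmult_plus_distr_r, Rmult_1_l, neg_sin, IH; ring. }
  rewrite S; ring.
Qed.

Lemma sum_f_R0_pairs (g : nat -> R) n :
  sum_f_R0 g (2 * n + 1) = sum_f_R0 (fun k => g (2 * k)%nat + g (2 * k + 1)%nat) n.
Proof.
  induction n as [|n IH]; [reflexivity|].
  replace (2 * S n + 1)%nat with (S (S (2 * n + 1))) by lia.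
  rewrite !tech5, IH, Rplus_assoc; do 2 f_equal; f_equal; lia.
Qed.

Lemma cos_even_taylor_bound y n :
  Rabs (cos y - sum_f_R0 (fun k => (-1) ^ k * y ^ (2 * k) / INR (fact (2 * k))) n) <=
  Rabs y ^ (2 * n + 2) / INR (fact (2 * n + 2)).
Proof.
  (* The Taylor polynomial of order 2n + 1 has no odd terms. *)
  assert (H := cos_taylor_bound 0 y (2 * n + 1)).
  replace (S (2 * n + 1)) with (2 * n + 2)%nat in H by lia.
  rewrite Rplus_0_l, sum_f_R0_pairs in H.
  eapply Rle_trans; [|apply H]. right; f_equal; f_equal.
  apply sum_eq; intros k _. rewrite !Rplus_0_l, cos_even_PI2, cos_odd_PI2.
  field; split; apply INR_fact_neq_0.
Qed.

Definition saddle_integral (phi v : R) : R := improper (saddle_kernel phi v).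

Lemma dominated_saddle phi v : dominated (saddle_kernel phi v).
Proof.
  unfold saddle_kernel.
  apply dominated_le with (fun r => r ^ 0 * exp (- (sqrt 3 / 2) * r ^ 2)).
  - smooth.
  - apply dominated_gauss, sqrt3_half_pos.
  - intros t _; rewrite !Rabs_mult, (Rabs_pos_eq (exp _)) by (left; apply exp_pos).
    assert (A := Rabs_cos_le (phi - t ^ 2 / 2)). assert (B := Rabs_cos_le (t ^ 3 / (3 * v ^ 3))).
    assert (A0 := Rabs_pos (cos (phi - t ^ 2 / 2))). assert
      (B0 := Rabs_pos (cos (t ^ 3 / (3 * v ^ 3)))).
    rewrite Rmult_assoc, Rmult_comm. apply Rmult_le_compat_r; [left; apply exp_pos|].
    simpl (t ^ 0). nra.
Qed.

(** The Taylor remainder of the cosine of r^3/(3 v^3) is a multiple of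
    r^(6n+6) / v^(6n+6), which the Gaussian integrates to a constant. *)
Lemma saddle_expansion phi n : exists M, forall v, 0 < v ->
  Rabs (saddle_integral phi v -
    sum_f_R0 (fun k => (-1) ^ k / (9 ^ k * INR (fact (2 * k))) * rotated_moment (6 * k) phi /
      (v ^ 6) ^ k) n)
  <= M / (v ^ 6) ^ S n.
Proof.
  set (g := fun r => r ^ (6 * S n) * exp (- (sqrt 3 / 2) * r ^ 2)).
  assert (Dg : dominated g) by apply dominated_gauss, sqrt3_half_pos.
  set (c := / (9 ^ S n * INR (fact (2 * S n)))).
  exists (c * improper g); intros v Hv.
  set (f := fun k r => ((-1) ^ k / (9 ^ k * INR (fact (2 * k))) / (v ^ 6) ^ k) * gauss_kernel
    (6 * k) phi r).
  assert (Df : forall k, dominated (f k)) by (intros; apply dominated_scal, dominated_kernel).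
  destruct (dominated_sum f n Df) as [DS ES].
  assert (E : saddle_integral phi v - sum_f_R0 (fun k => (-1) ^ k / (9 ^ k * INR (fact (2 * k))) *
    rotated_moment (6 * k) phi / (v ^ 6) ^ k) n
    = improper (fun r => saddle_kernel phi v r + -1 * sum_f_R0 (fun k => f k r) n)).
  { rewrite improper_plus, improper_scal, ES; auto using dominated_saddle, dominated_scal.
    unfold saddle_integral. 
    rewrite (sum_eq (fun k => improper (f k)) (fun k => (-1) ^ k / (9 ^ k * INR (fact (2 * k))) *
      rotated_moment (6 * k) phi / (v ^ 6) ^ k)).
    - ring.
    - intros k _; unfold f, rotated_moment. rewrite improper_scal by apply dominated_kernel.
        unfold Rdiv; ring. }
  rewrite E.
  assert (V : 0 < (v ^ 6) ^ S n) by (now apply pow_lt, pow_lt).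
  replace (c * improper g / (v ^ 6) ^ S n) with (improper (fun r => (c / (v ^ 6) ^ S n) * g r)).
  2: { rewrite improper_scal by auto; field; lra. }
  apply improper_abs_le; auto using dominated_plus, dominated_saddle, dominated_scal.
  intros r Hr. unfold saddle_kernel, f, gauss_kernel, g.
  set (y := r ^ 3 / (3 * v ^ 3)).
  assert (B := cos_even_taylor_bound y n).
  assert (v3 : v ^ 3 <> 0) by (apply pow_nonzero; lra).
  assert (Y : forall k, y ^ (2 * k) = r ^ (6 * k) / (9 ^ k * (v ^ 6) ^ k)).
  { intros k. replace (6 * k)%nat with (3 * (2 * k))%nat by lia.
    replace (9 ^ k * (v ^ 6) ^ k) with ((3 * v ^ 3) ^ (2 * k)).
    - unfold y, Rdiv; rewrite Rpow_mult_distr, pow_inv, (pow_mult r 3 (2 * k)); reflexivity.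
    - rewrite pow_mult, <- Rpow_mult_distr; f_equal; ring. }
  set (e := exp (- (sqrt 3 / 2) * r ^ 2)). set (cp := cos (phi - r ^ 2 / 2)).
  replace (e * cp * cos y + -1 * _) with
    ((e * cp) * (cos y - sum_f_R0 (fun k => (-1) ^ k * y ^ (2 * k) / INR (fact (2 * k))) n)).
  - rewrite Rabs_mult, Rabs_mult, (Rabs_pos_eq e) by (left; apply exp_pos).
    replace (c / (v ^ 6) ^ S n * (r ^ (6 * S n) * e)) with
      (e * 1 * (y ^ (2 * S n) / INR (fact (2 * S n)))).
    + apply Rmult_le_compat.
      * apply Rmult_le_pos; [left; apply exp_pos|apply Rabs_pos].
      * apply Rabs_pos.
      * apply Rmult_le_compat_l; [left; apply exp_pos|apply Rabs_cos_le].
      * replace (2 * S n)%nat with (2 * n + 2)%nat by lia.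
        rewrite (Rabs_pos_eq y) in B; [exact B|].
        unfold y; apply Rmult_le_pos; [now apply pow_le|].
        left; apply Rinv_0_lt_compat. assert (0 < v ^ 3) by now apply pow_lt. lra.
    + rewrite Y. unfold c. field; nonzero.
  - rewrite Rmult_minus_distr_l. rewrite scal_sum, (scal_sum _ _ (-1)).
    unfold Rminus; f_equal.
    rewrite <- (Rmult_1_l (sum_f_R0 _ n)), Ropp_mult_distr_l, scal_sum.
    apply sum_eq; intros k _. rewrite Y. fold e cp. field; nonzero.
Qed.

(** * Strong asymptotic expansions *)

Lemma Rinv_pow_Rpower u m : 0 < u -> / u ^ m = Rpower u (- INR m).
Proof. intros Hu; rewrite Rpower_Ropp, Rpower_pow; auto. Qed.

Lemma Rle_Rpower_base_ge_1 u a b : 1 <= u -> a <= b -> Rpower u a <= Rpower u b.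
Proof.
  intros Hu Hab; unfold Rpower; apply exp_le.
  assert (0 <= ln u) by (rewrite <- ln_1; apply ln_le; lra). nra.
Qed.

(** If the leading coefficient c is positive and p is an exact common factor of f and of
    the terms, an ordinary asymptotic expansion of q = f / p is a strong one: the
    partial sums tend to c, so dividing by them keeps the order of the remainder. *)
Lemma strong_expansion_intro (f : R -> R) (t : nat -> R -> R) (p q : R -> R) (s : nat -> R ->
  R) (c : R) :
  0 < c ->
  (forall k u, (1 <= k)%nat -> 0 < u -> t k u = p u * s k u) ->
  (forall u, 0 < u -> f u = p u * q u) ->
  (forall u, 0 < u -> s 1%nat u = c) ->
  (forall n, exists M, forall u, 1 <= u ->
     Rabs (q u - sum_n_m (fun k => s k u) 1 (S n)) <= M / u ^ (2 * n + 1)) ->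
  strong_asymptotic_expansion f t.
Proof.
  intros Hc Ht Hf Hs Hq alpha Ha.
  destruct (nfloor_ex alpha) as [N0 [_ HN0]]; [lra|].
  (* The partial sum of N terms is within O(u^-(2N-1)), so any N above alpha will do. *)
  exists (S (S N0)); intros [|n] Hn; [lia|].
  destruct (Hq 0%nat) as [M0 H0]. destruct (Hq n) as [M HM].
  set (S_ := fun u => sum_n_m (fun k => s k u) 1 (S n)).
  set (M' := Rabs M0 + Rabs M).
  (* Both c and the partial sum are within O(1/u) of q. *)
  assert (Hlow : forall u, Rmax 1 (2 * M' / c) < u -> c / 2 <= S_ u).
  { intros u Hu.
    assert (U1 : 1 <= u) by (left; apply Rle_lt_trans with (2 := Hu); apply Rmax_l).
    assert (U2 : 2 * M' / c < u) by (apply Rle_lt_trans with (2 := Hu); apply Rmax_r).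
    specialize (H0 u U1). specialize (HM u U1). fold (S_ u) in HM.
    rewrite sum_n_n, Hs in H0 by lra.
    replace (2 * 0 + 1)%nat with 1%nat in H0 by lia. rewrite pow_1 in H0.
    assert (I : 0 < / u) by (apply Rinv_0_lt_compat; lra).
    assert (B0 : M0 / u <= Rabs M0 * / u) by (apply Rmult_le_compat_r; [lra|apply Rle_abs]).
    assert (B1 : M / u ^ (2 * n + 1) <= Rabs M * / u).
    { apply Rle_trans with (Rabs M * / u ^ (2 * n + 1)).
      - apply Rmult_le_compat_r; [left; apply Rinv_0_lt_compat, pow_lt; lra|apply Rle_abs].
      - apply Rmult_le_compat_l; [apply Rabs_pos|].
        apply Rinv_le_contravar; [lra|]. rewrite <- (pow_1 u) at 1. apply Rle_pow; [lra|lia]. }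
    assert (B2 : M' * / u <= c / 2).
    { apply Rmult_le_reg_r with u; [lra|]. rewrite Rmult_assoc, Rinv_l by lra.
      apply Rmult_lt_compat_r with (r := c) in U2; [|lra].
      replace (2 * M' / c * c) with (2 * M') in U2 by (field; lra). lra. }
    unfold M' in B2. rewrite Rmult_plus_distr_r in B2.
    apply Rabs_le_between in H0; apply Rabs_le_between in HM. lra. }
  exists (fun u => q u / S_ u); split.
  - exists (2 * Rabs M / c), (Rmax 1 (2 * M' / c)); intros u Hu.
    specialize (Hlow u Hu).
    assert (U1 : 1 <= u) by (left; apply Rle_lt_trans with (2 := Hu); apply Rmax_l).
    specialize (HM u U1). fold (S_ u) in HM.
    replace (q u / S_ u - 1) with ((q u - S_ u) * / S_ u) by (field; lra).
    rewrite Rabs_mult, (Rabs_pos_eq (/ _)) by (left; apply Rinv_0_lt_compat; lra).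
    replace (2 * Rabs M / c * Rpower u (- alpha)) with (Rabs M * Rpower u (- alpha) * (2 / c))
      by (field; lra).
    apply Rmult_le_compat; [apply Rabs_pos|left; apply Rinv_0_lt_compat; lra| |].
    + apply Rle_trans with (1 := HM). unfold Rdiv; apply Rle_trans with
        (Rabs M * / u ^ (2 * n + 1)).
      * apply Rmult_le_compat_r; [left; apply Rinv_0_lt_compat, pow_lt; lra|apply Rle_abs].
      * apply Rmult_le_compat_l; [apply Rabs_pos|]. rewrite Rinv_pow_Rpower by lra.
        apply Rle_Rpower_base_ge_1; auto. apply Ropp_le_contravar.
        apply Rle_trans with (INR (S N0)); [rewrite S_INR; lra|]. apply le_INR; lia.
    + replace (2 / c) with (/ (c / 2)) by (field; lra). apply Rinv_le_contravar; lra.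
  - exists (Rmax 1 (2 * M' / c)); intros u Hu. specialize (Hlow u Hu).
    assert (U1 : 1 < u) by (apply Rle_lt_trans with (2 := Hu); apply Rmax_l).
    rewrite Hf by lra.
    rewrite (sum_n_m_ext_loc _ (fun k => mult (p u) (s k u))).
    + rewrite (sum_n_m_mult_l (K := R_Ring)). change (p u * q u = p u * S_ u * (q u / S_ u)).
        field; lra.
    + intros k Hk; apply Ht; [lia|lra].
Qed.

Lemma sum_pairs_n_m (g : nat -> R) n :
  sum_f_R0 g (2 * n + 1) =
  sum_n_m (fun k => g (2 * (k - 1))%nat) 1 (S n) + sum_n_m (fun k => g (2 * k - 1)%nat) 1 (S n).
Proof.
  induction n as [|n IH].
  - rewrite !sum_n_n; reflexivity.
  - replace (2 * S n + 1)%nat with (S (S (2 * n + 1))) by lia.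
    rewrite !tech5, IH, !(sum_n_Sm _ 1 (S n)) by lia.
    unfold plus; simpl plus.
    replace (2 * (S (S n) - 1))%nat with (S (2 * n + 1)) by lia.
    replace (2 * S (S n) - 1)%nat with (S (S (2 * n + 1))) by lia.
    simpl; ring.
Qed.

Lemma sum_n_m_zero (g : nat -> R) n :
  (forall k, (1 <= k)%nat -> g k = 0) -> sum_n_m g 1 (S n) = 0.
Proof.
  intros H; rewrite (sum_n_m_ext_loc _ (fun _ => zero)) by (intros k Hk; apply H; lia).
  apply (sum_n_m_const_zero (G := R_AbelianMonoid)).
Qed.

(** Normalised so that the coefficients of the expansion are the numbers airy_coef. *)
Definition scaled_saddle (phi u : R) : R :=
  4 * sqrt PI * saddle_integral phi (Rpower u (/ 6)).

Lemma sixth_root_pow u : 0 < u -> Rpower u (/ 6) ^ 6 = u.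
Proof.
  intros Hu; rewrite <- Rpower_pow by apply exp_pos. rewrite Rpower_mult.
  replace (/ 6 * INR 6) with 1 by (simpl; field). now apply Rpower_1.
Qed.

Lemma scaled_saddle_expansion phi n : exists M, forall u, 0 < u ->
  Rabs (scaled_saddle phi u -
    sum_f_R0 (fun k => (-1) ^ k * cos (phi - PI / 12 - INR k * (PI / 2)) * (airy_coef k / u ^ k)) n)
  <= M / u ^ S n.
Proof.
  destruct (saddle_expansion phi n) as [M HM].
  assert (P := PI_RGT_0). assert (SP : 0 < sqrt PI) by now apply sqrt_lt_R0.
  exists (4 * sqrt PI * M); intros u Hu.
  assert (V : 0 < Rpower u (/ 6)) by apply exp_pos.
  specialize (HM _ V). rewrite sixth_root_pow in HM by auto.
  replace (4 * sqrt PI * M / u ^ S n) with (4 * sqrt PI * (M / u ^ S n)) by (unfold Rdiv; ring).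
  unfold scaled_saddle.
  apply Rmult_le_compat_l with (r := 4 * sqrt PI) in HM; [|lra].
  rewrite <- (Rabs_pos_eq (4 * sqrt PI)) in HM at 1 by lra.
  rewrite <- Rabs_mult, Rmult_minus_distr_l, scal_sum in HM.
  eapply Rle_trans; [|exact HM]. right; do 2 f_equal.
  apply sum_eq; intros k _. rewrite rotated_moment_6.
  transitivity ((-1) ^ k * (moment_coef k / (9 ^ k * INR (fact (2 * k)))) *
    (2 * (sqrt PI * sqrt PI)) *
    cos (phi - PI / 12 - INR k * (PI / 2)) / u ^ k).
  - rewrite moment_coef_airy, sqrt_sqrt by lra. field; nonzero.
  - field. nonzero.
Qed.

Lemma weaken_remainder M u n : 1 <= u -> M / u ^ S n <= Rabs M / u ^ n.
Proof.
  intros Hu; unfold Rdiv; apply Rle_trans with (Rabs M * / u ^ S n).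
  - apply Rmult_le_compat_r; [left; apply Rinv_0_lt_compat, pow_lt; lra|apply Rle_abs].
  - apply Rmult_le_compat_l; [apply Rabs_pos|].
    apply Rinv_le_contravar; [apply pow_lt; lra|apply Rle_pow; [lra|lia]].
Qed.

Definition prefactor (u : R) : R := Rpower u (- (1 / 6)) / (2 * Rpower PI (3 / 2)).

(** For the phase PI/12 the coefficients of odd index carry the factor cos(n PI/2) = 0. *)
Lemma even_expansion (f : R -> R) :
  (forall u, 0 < u -> f u =
     prefactor u * cos (PI / 4 - 2 / 3 * u) * scaled_saddle (PI / 12) u) ->
  strong_asymptotic_expansion f Ai0_term.
Proof.
  intros Hf.
  apply (strong_expansion_intro f _ (fun u => prefactor u * cos (PI / 4 - 2 / 3 * u))
    (scaled_saddle (PI / 12))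
    (fun k u => (-1) ^ (k - 1) * (airy_coef (2 * (k - 1)) / u ^ (2 * (k - 1)))) (airy_coef 0)).
  - apply airy_coef_pos.
  - intros k u Hk Hu. unfold Ai0_term. fold (prefactor u).
    replace (2 * (k - 1) / 2)%nat with (k - 1)%nat by (rewrite Nat.mul_comm, Nat.div_mul; lia).
    unfold Rdiv; ring.
  - exact Hf.
  - intros u Hu; simpl; field.
  - intros n. destruct (scaled_saddle_expansion (PI / 12) (2 * n + 1)) as [M HM].
    exists (Rabs M); intros u Hu. assert (U : 0 < u) by lra. specialize (HM u U).
    rewrite sum_pairs_n_m in HM.
    rewrite (sum_n_m_zero (fun k => (-1) ^ (2 * k - 1) * _ * _)), Rplus_0_r in HM.
    + rewrite (sum_n_m_ext_loc _ (fun k => (-1) ^ (k - 1) *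
        (airy_coef (2 * (k - 1)) / u ^ (2 * (k - 1))))) in HM.
      * apply Rle_trans with (1 := HM). now apply weaken_remainder.
      * intros k Hk. rewrite Rminus_diag, Rminus_0_l, cos_neg, cos_even_PI2, pow_1_even. in_reals;
          ring.
    + intros k Hk. rewrite Rminus_diag, Rminus_0_l, cos_neg.
      replace (2 * k - 1)%nat with (2 * (k - 1) + 1)%nat by lia. rewrite cos_odd_PI2; in_reals;
        ring.
Qed.

(** The additional phase - PI/2 leaves the odd indices.  The factor 1/u of the leading
    term is moved into the common factor. *)
Lemma odd_expansion (f : R -> R) :
  (forall u, 0 < u -> f u =
     - prefactor u * sin (PI / 4 - 2 / 3 * u) * scaled_saddle (PI / 12 - PI / 2) u) ->
  strong_asymptotic_expansion f Ai1_term.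
Proof.
  intros Hf.
  apply (strong_expansion_intro f _ (fun u => - prefactor u * sin (PI / 4 - 2 / 3 * u) / u)
    (fun u => u * scaled_saddle (PI / 12 - PI / 2) u)
    (fun k u => u * ((-1) ^ (k - 1) * (airy_coef (2 * k - 1) / u ^ (2 * k - 1)))) (airy_coef 1)).
  - apply airy_coef_pos.
  - intros k u Hk Hu. unfold Ai1_term. fold (prefactor u).
    replace ((2 * k - 1 - 1) / 2)%nat with (k - 1)%nat.
    2: { replace (2 * k - 1 - 1)%nat with ((k - 1) * 2)%nat by lia. rewrite Nat.div_mul; lia. }
    field; split; [apply pow_nonzero|]; lra.
  - intros u Hu. rewrite Hf by auto. field; lra.
  - intros u Hu; simpl; field; lra.
  - intros n. destruct (scaled_saddle_expansion (PI / 12 - PI / 2) (2 * n + 1)) as [M HM].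
    exists M; intros u Hu. assert (U : 0 < u) by lra. specialize (HM u U).
    assert (PH : forall k, cos (PI / 12 - PI / 2 - PI / 12 - INR k * (PI / 2)) = cos
      (INR (k + 1) * (PI / 2))).
    { intros k. rewrite <- cos_neg, plus_INR; f_equal; simpl; field. }
    rewrite sum_pairs_n_m in HM.
    rewrite (sum_n_m_zero (fun k => (-1) ^ (2 * (k - 1)) * _ * _)), Rplus_0_l in HM.
    + rewrite (sum_n_m_ext_loc _ (fun k => (-1) ^ (k - 1) *
        (airy_coef (2 * k - 1) / u ^ (2 * k - 1)))) in HM.
      * rewrite (sum_n_m_mult_l (K := R_Ring)).
        match goal with |- Rabs (_ - mult _ ?S) <= _ =>
          change (Rabs (u * scaled_saddle (PI / 12 - PI / 2) u - u * S) <= M / u ^ (2 * n + 1)) end.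
        rewrite <- Rmult_minus_distr_l, Rabs_mult, (Rabs_pos_eq u) by lra.
        replace (M / u ^ (2 * n + 1)) with (u * (M / u ^ S (2 * n + 1))).
        -- apply Rmult_le_compat_l; [lra|exact HM].
        -- change (u ^ S (2 * n + 1)) with (u * u ^ (2 * n + 1)). field; split;
             [apply pow_nonzero|]; lra.
      * intros k Hk. rewrite PH. replace (2 * k - 1 + 1)%nat with (2 * k)%nat by lia. rewrite
          cos_even_PI2.
        replace (2 * k - 1)%nat with (S (2 * (k - 1))) at 1 by lia. rewrite pow_1_odd.
        destruct k as [|k]; [lia|]. replace (S k - 1)%nat with k by lia. simpl ((-1) ^ S k).
          in_reals; ring.
    + intros k Hk. rewrite PH, cos_odd_PI2; in_reals; ring.
Qed.

(** * Closure properties of real analytic functions *)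

Lemma bounded_CV_radius (a : nat -> R) (rho B h : R) :
  (forall n, Rabs (a n) * rho ^ n <= B) -> Rabs h < rho -> Rbar_lt (Rabs h) (CV_radius a).
Proof.
  intros Ha Hh.
  apply Rbar_lt_le_trans with rho; [exact Hh|].
  apply (proj1 (CV_radius_bounded a)). exists B; intros n.
  assert (0 <= rho) by (generalize (Rabs_pos h); lra).
  rewrite Rabs_mult, (Rabs_pos_eq (rho ^ n)) by (now apply pow_le). apply Ha.
Qed.

(** Convergence at r/2 bounds the coefficients by a geometric sequence; in this form
    the data of several functions can be combined. *)
Lemma analytic_coeffs (f : R -> R) (x0 : R) : real_analytic_at f x0 ->
  exists (a : nat -> R) (rho B : R), 0 < rho /\ (forall n, Rabs (a n) * rho ^ n <= B) /\
    (forall h, Rabs h < rho -> is_pseries a h (f (x0 + h))).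
Proof.
  intros [a [r [Hr H]]].
  assert (Hp : forall h, Rabs h < r -> is_pseries a h (f (x0 + h))).
  { intros h Hh. replace h with (x0 + h - x0) at 1 by ring. apply H.
    replace (x0 + h - x0) with h by ring; exact Hh. }
  exists a, (r / 2).
  (* The terms of a convergent series are bounded. *)
  assert (Hs : is_lim_seq (fun n => a n * (r / 2) ^ n) 0).
  { apply ex_series_lim_0. exists (f (x0 + r / 2)); apply (proj1 (is_pseries_R _ _ _)), Hp.
    rewrite Rabs_pos_eq; lra. }
  destruct (filterlim_bounded (V := R_NormedModule) _ (ex_intro _ 0 Hs)) as [B HB].
  exists B; split; [lra|split].
  - intros n. specialize (HB n). change (Rabs (a n * (r / 2) ^ n) <= B) in HB.
    rewrite Rabs_mult, (Rabs_pos_eq (_ ^ n)) in HB by (apply pow_le; lra). exact HB.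
  - intros h Hh; apply Hp; lra.
Qed.

Lemma analytic_ext_loc (f g : R -> R) x0 (d : R) : 0 < d ->
  (forall x, Rabs (x - x0) < d -> f x = g x) -> real_analytic_at f x0 -> real_analytic_at g x0.
Proof.
  intros Hd E [a [r [Hr H]]]. exists a, (Rmin d r); split; [now apply Rmin_glb_lt|].
  intros x Hx. rewrite <- E.
  - apply H; apply Rlt_le_trans with (1 := Hx); apply Rmin_r.
  - apply Rlt_le_trans with (1 := Hx); apply Rmin_l.
Qed.

Lemma analytic_plus (f g : R -> R) x0 :
  real_analytic_at f x0 -> real_analytic_at g x0 -> real_analytic_at (fun x => f x + g x) x0.
Proof.
  intros [a [r [Hr Ha]]] [b [s [Hs Hb]]].
  exists (PS_plus a b), (Rmin r s); split; [now apply Rmin_glb_lt|].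
  intros x Hx. apply (is_pseries_plus (V := R_NormedModule)).
  - apply Ha, Rlt_le_trans with (1 := Hx), Rmin_l.
  - apply Hb, Rlt_le_trans with (1 := Hx), Rmin_r.
Qed.

Lemma analytic_mult (f g : R -> R) x0 :
  real_analytic_at f x0 -> real_analytic_at g x0 -> real_analytic_at (fun x => f x * g x) x0.
Proof.
  intros Hf Hg.
  destruct (analytic_coeffs f x0 Hf) as [a [r [A [Hr [Ba Ha]]]]].
  destruct (analytic_coeffs g x0 Hg) as [b [s [B [Hs [Bb Hb]]]]].
  exists (PS_mult a b), (Rmin r s); split; [now apply Rmin_glb_lt|].
  intros x Hx.
  assert (X1 : Rabs (x - x0) < r) by (apply Rlt_le_trans with (1 := Hx), Rmin_l).
  assert (X2 : Rabs (x - x0) < s) by (apply Rlt_le_trans with (1 := Hx), Rmin_r).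
  replace x with (x0 + (x - x0)) at 2 3 by ring.
  apply is_pseries_mult; auto; eapply bounded_CV_radius; eauto.
Qed.

Lemma analytic_const c x0 : real_analytic_at (fun _ => c) x0.
Proof.
  exists (fun n => match n with O => c | _ => 0 end), 1; split; [lra|]. intros x _.
  apply (proj2 (is_pseries_R _ _ _)).
  apply (filterlim_ext (fun _ => c)); [|apply filterlim_const].
  intros n; induction n as [|n IH].
  - rewrite sum_O; simpl; ring.
  - rewrite sum_Sn, <- IH; unfold plus; simpl; ring.
Qed.

Lemma analytic_scal c (f : R -> R) x0 :
  real_analytic_at f x0 -> real_analytic_at (fun x => c * f x) x0.
Proof. intros Hf; apply (analytic_mult (fun _ => c)); auto using analytic_const. Qed.

Section LinearODE.

Variables (P Q : nat -> R) (y0 w0 : R).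

(** The recursion that the Taylor coefficients (Y, W) of a solution of y' = p y - q w,
    w' = q y + p w satisfy, P and Q being those of p and q.  In complex terms:
    z' = (p + i q) z for z = y + i w. *)
Definition ode_step (s : nat -> R * R) (n : nat) : R * R :=
  (/ INR (S n) * sum_f_R0 (fun k => P k * fst (s (n - k)%nat) - Q k * snd (s (n - k)%nat)) n,
   / INR (S n) * sum_f_R0 (fun k => Q k * fst (s (n - k)%nat) + P k * snd (s (n - k)%nat)) n).

(** Course-of-values recursion: [ode_table n] is correct up to index n. *)
Fixpoint ode_table (n : nat) : nat -> R * R :=
  match n with
  | O => fun _ => (y0, w0)
  | S p => fun m => if Nat.leb m p then ode_table p m else ode_step (ode_table p) p
  end.

Definition ode_seq (n : nat) : R * R := ode_table n n.

Lemma ode_table_stable n m : (m <= n)%nat -> ode_table n m = ode_seq m.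
Proof.
  induction n as [|n IH]; intros H.
  - replace m with 0%nat by lia; reflexivity.
  - destruct (Nat.eq_dec m (S n)) as [->|Hn]; [reflexivity|].
    simpl. destruct (Nat.leb_spec m n); [apply IH; lia|lia].
Qed.

Lemma ode_seq_S n : ode_seq (S n) = ode_step ode_seq n.
Proof.
  unfold ode_seq at 1; cbn [ode_table].
  replace (Nat.leb (S n) n) with false by (symmetry; apply Nat.leb_gt; lia).
  unfold ode_step; f_equal; f_equal; apply sum_eq; intros k Hk; rewrite !ode_table_stable by lia;
    reflexivity.
Qed.

(** Majorant argument: if |P_k| and |Q_k| are at most B / rho^k, a bound D / sigma^k up
    to index n with sigma <= rho gives 2 B D / sigma^n at index n + 1, which is enough
    when 2 B sigma <= 1. *)
Lemma ode_seq_bound rho B : 0 < rho -> 0 <= B ->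
  (forall n, Rabs (P n) * rho ^ n <= B) -> (forall n, Rabs (Q n) * rho ^ n <= B) ->
  exists sigma, 0 < sigma <= rho /\
    forall n, (Rabs (fst (ode_seq n)) + Rabs (snd (ode_seq n))) * sigma ^ n <= Rabs y0 + Rabs w0.
Proof.
  intros Hr HB HP HQ.
  set (D := Rabs y0 + Rabs w0).
  assert (HD : 0 <= D) by (generalize (Rabs_pos y0) (Rabs_pos w0); unfold D; lra).
  (* 1 / sigma = 1 / rho + 2 B meets both constraints on sigma. *)
  set (sg := / (/ rho + 2 * B)).
  assert (Hi : 0 < / rho) by now apply Rinv_0_lt_compat.
  assert (Hsg : 0 < sg) by (apply Rinv_0_lt_compat; lra).
  assert (Hsr : sg <= rho).
  { unfold sg; rewrite <- (Rinv_inv rho) at 2. apply Rinv_le_contravar; lra. }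
  assert (HsB : sg * (2 * B) <= 1).
  { assert (E : sg * (/ rho + 2 * B) = 1) by (apply Rinv_l; lra). nra. }
  exists sg; split; [lra|].
  intros n; induction n as [n IH] using (well_founded_induction Wf_nat.lt_wf).
  destruct n as [|n]; [unfold ode_seq; simpl; unfold D; lra|].
  rewrite ode_seq_S; unfold ode_step; cbn [fst snd].
  set (I := / INR (S n)).
  assert (HI : 0 < I) by (apply Rinv_0_lt_compat, lt_0_INR; lia).
  assert (HIn : I * INR (S n) = 1) by (apply Rinv_l, not_0_INR; lia).
  rewrite !Rabs_mult, (Rabs_pos_eq I) by lra.
  assert (T : forall k, (k <= n)%nat ->
    (Rabs (P k) + Rabs (Q k)) * (Rabs (fst (ode_seq (n - k))) + Rabs (snd (ode_seq (n - k)))) * sg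
      ^ n <= 2 * B * D).
  { intros k Hk.
    assert (IHk := IH (n - k)%nat ltac:(lia)).
    assert (HPk := HP k). assert (HQk := HQ k).
    assert (Pk : Rabs (P k) * sg ^ k <= B).
    { apply Rle_trans with (2 := HPk); apply Rmult_le_compat_l;
        [apply Rabs_pos|apply pow_incr; lra]. }
    assert (Qk : Rabs (Q k) * sg ^ k <= B).
    { apply Rle_trans with (2 := HQk); apply Rmult_le_compat_l;
        [apply Rabs_pos|apply pow_incr; lra]. }
    replace (sg ^ n) with (sg ^ k * sg ^ (n - k)) by (rewrite <- pow_add; f_equal; lia).
    set (X := Rabs (fst (ode_seq (n - k))) + Rabs (snd (ode_seq (n - k)))) in *.
    replace ((Rabs (P k) + Rabs (Q k)) * X * (sg ^ k * sg ^ (n - k))) with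
      ((Rabs (P k) * sg ^ k + Rabs (Q k) * sg ^ k) * (X * sg ^ (n - k))) by ring.
    assert (0 <= sg ^ k) by (apply pow_le; lra). assert (0 <= sg ^ (n - k)) by (apply pow_le; lra).
    assert (0 <= X) by (unfold X; generalize (Rabs_pos (fst (ode_seq (n - k))))
      (Rabs_pos (snd (ode_seq (n - k)))); lra).
    apply Rmult_le_compat.
    - generalize (Rabs_pos (P k)) (Rabs_pos (Q k)); intros; nra.
    - now apply Rmult_le_pos.
    - lra.
    - exact IHk. }
  set (g := fun k => (Rabs (P k) + Rabs (Q k)) * (Rabs (fst (ode_seq (n - k))) + Rabs
    (snd (ode_seq (n - k))))).
  assert (S1 : Rabs (sum_f_R0 (fun k => P k * fst (ode_seq (n - k)) - Q k * snd (ode_seq (n - k)))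
    n) +
     Rabs (sum_f_R0 (fun k => Q k * fst (ode_seq (n - k)) + P k * snd (ode_seq (n - k))) n) <=
       sum_f_R0 g n).
  { eapply Rle_trans; [apply Rplus_le_compat; apply Rsum_abs|].
    rewrite <- plus_sum. apply sum_Rle; intros k Hk; unfold g.
    set (u := fst (ode_seq (n - k))); set (v := snd (ode_seq (n - k))).
    assert (A1 := Rabs_triang (P k * u) (- (Q k * v))). assert
      (A2 := Rabs_triang (Q k * u) (P k * v)).
    rewrite Rabs_Ropp in A1. rewrite !Rabs_mult in A1, A2. unfold Rminus. lra. }
  assert (S2 : sum_f_R0 g n * sg ^ n <= 2 * B * D * INR (S n)).
  { rewrite Rmult_comm, scal_sum. rewrite <- sum_cte. apply sum_Rle; intros k Hk. apply T, Hk. }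
  assert (0 <= sg ^ n) by (apply pow_le; lra).
  simpl (sg ^ S n).
  apply Rle_trans with (I * (sum_f_R0 g n * sg ^ n) * sg).
  - set (a1 := Rabs (sum_f_R0 (fun k => P k * _ - _) n)) in *.
    set (a2 := Rabs (sum_f_R0 (fun k => Q k * _ + _) n)) in *.
    replace ((I * a1 + I * a2) * (sg * sg ^ n)) with (I * ((a1 + a2) * sg ^ n) * sg) by ring.
    apply Rmult_le_compat_r; [lra|]. apply Rmult_le_compat_l; [lra|]. now apply Rmult_le_compat_r.
  - apply Rle_trans with (I * (2 * B * D * INR (S n)) * sg).
    + apply Rmult_le_compat_r; [lra|]. apply Rmult_le_compat_l; lra.
    + replace (I * (2 * B * D * INR (S n)) * sg) with ((I * INR (S n)) * (sg * (2 * B)) * D)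
        by ring.
      rewrite HIn. nra.
Qed.

End LinearODE.

Lemma derive_sign_mono (E E' : R -> R) (a b : R) : a <= b ->
  (forall t, a <= t <= b -> is_derive E t (E' t)) -> (forall t, a <= t <= b -> 0 <= E' t) ->
    E a <= E b.
Proof.
  intros Hab HE Hp.
  destruct (MVT_gen E a b E') as [c [Hc Ec]].
  - intros t Ht; rewrite Rmin_left, Rmax_right in Ht by lra; apply HE; lra.
  - intros t Ht; rewrite Rmin_left, Rmax_right in Ht by lra.
    apply derivable_continuous_pt; exists (E' t); apply is_derive_Reals, HE; lra.
  - rewrite Rmin_left, Rmax_right in Hc by lra. specialize (Hp c ltac:(lra)). nra.
Qed.

(** Multiply E by exp(-2 B t) for t > 0 and by exp(2 B t) for t < 0 to make it monotone. *)
Lemma gronwall_zero (E p : R -> R) (d B : R) : 0 < d ->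
  (forall t, Rabs t < d -> is_derive E t (2 * p t * E t)) ->
  (forall t, Rabs t < d -> Rabs (p t) <= B) ->
  (forall t, 0 <= E t) -> E 0 = 0 ->
  forall t, Rabs t < d -> E t = 0.
Proof.
  intros Hd HE Hp Hpos H0 t Ht. apply Rle_antisym; auto.
  apply Rabs_lt_between in Ht.
  destruct (Rle_lt_dec 0 t) as [T|T].
  - assert (M : (fun s => - (E s * exp (- 2 * B * s))) 0 <= (fun s => - (E s * exp (- 2 * B * s)))
      t).
    { apply (derive_sign_mono (fun s => - (E s * exp (- 2 * B * s)))
        (fun s => 2 * (B - p s) * E s * exp (- 2 * B * s))); auto.
      - intros s Hs. assert (Hs' : Rabs s < d) by (apply Rabs_lt_between; lra).
        evar_last.
        + apply (is_derive_opp (V := R_NormedModule)).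
          apply (is_derive_mult (K := R_AbsRing) E (fun s => exp (- 2 * B * s)));
            [now apply HE| |intros; apply Rmult_comm].
          auto_derive; auto.
        + unfold opp, plus, mult; simpl; in_reals; ring.
      - intros s Hs. assert (Hs' : Rabs s < d) by (apply Rabs_lt_between; lra).
        assert (Q := Hp s Hs'). apply Rabs_le_between in Q.
        apply Rmult_le_pos; [|left; apply exp_pos]. apply Rmult_le_pos; auto; lra. }
    cbv beta in M. rewrite H0 in M. generalize (exp_pos (- 2 * B * t)) (Hpos t); intros; nra.
  - assert (M : (fun s => E s * exp (2 * B * s)) t <= (fun s => E s * exp (2 * B * s)) 0).
    { apply (derive_sign_mono (fun s => E s * exp (2 * B * s))
        (fun s => 2 * (B + p s) * E s * exp (2 * B * s))); auto; try lra.
      - intros s Hs. assert (Hs' : Rabs s < d) by (apply Rabs_lt_between; lra).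
        evar_last.
        + apply (is_derive_mult (K := R_AbsRing) E (fun s => exp (2 * B * s)));
            [now apply HE| |intros; apply Rmult_comm].
          auto_derive; auto.
        + unfold plus, mult; simpl; in_reals; ring.
      - intros s Hs. assert (Hs' : Rabs s < d) by (apply Rabs_lt_between; lra).
        assert (Q := Hp s Hs'). apply Rabs_le_between in Q.
        apply Rmult_le_pos; [|left; apply exp_pos]. apply Rmult_le_pos; auto; lra. }
    cbv beta in M. rewrite H0 in M. generalize (exp_pos (2 * B * t)) (Hpos t); intros; nra.
Qed.

(** Cauchy's existence theorem for linear equations, used as an analyticity criterion:
    the power series solution converges, and it equals the given solution because
    the squared distance E of the two satisfies E' = 2 p E and vanishes at x0. *)
Lemma analytic_linear_ode (y w p q : R -> R) (x0 d B : R) :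
  0 < d ->
  real_analytic_at p x0 -> real_analytic_at q x0 ->
  (forall x, Rabs (x - x0) < d -> is_derive y x (p x * y x - q x * w x)) ->
  (forall x, Rabs (x - x0) < d -> is_derive w x (q x * y x + p x * w x)) ->
  (forall x, Rabs (x - x0) < d -> Rabs (p x) <= B) ->
  real_analytic_at y x0 /\ real_analytic_at w x0.
Proof.
  intros Hd Hp Hq Hy Hw HB.
  destruct (analytic_coeffs p x0 Hp) as [P [r [A [Hr [BP HP]]]]].
  destruct (analytic_coeffs q x0 Hq) as [Q [s [C [Hs [BQ HQ]]]]].
  set (rho := Rmin r s). set (K := Rmax A C).
  assert (Hrho : 0 < rho) by now apply Rmin_glb_lt.
  assert (L : forall a t M, 0 < t -> rho <= t -> M <= K -> (forall n, Rabs (a n) * t ^ n <= M) ->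
    forall n, Rabs (a n) * rho ^ n <= K).
  { intros a t M Ht Hrt HM H n. apply Rle_trans with (2 := HM), Rle_trans with (2 := H n).
    apply Rmult_le_compat_l; [apply Rabs_pos|apply pow_incr; lra]. }
  assert (BP' := L P r A Hr (Rmin_l _ _) (Rmax_l _ _) BP).
  assert (BQ' := L Q s C Hs (Rmin_r _ _) (Rmax_r _ _) BQ).
  assert (K0 : 0 <= K) by (specialize (BP' 0%nat); simpl in BP'; generalize (Rabs_pos (P 0%nat));
    lra).
  destruct (ode_seq_bound P Q (y x0) (w x0) rho K Hrho K0 BP' BQ') as [sg [[Hsg Hsr] BS]].
  set (S_ := ode_seq P Q (y x0) (w x0)) in *.
  set (Y := fun n => fst (S_ n)). set (W := fun n => snd (S_ n)).
  set (D := Rabs (y x0) + Rabs (w x0)) in *.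
  assert (BY : forall n, Rabs (Y n) * sg ^ n <= D).
  { intros n. apply Rle_trans with (2 := BS n). apply Rmult_le_compat_r; [apply pow_le; lra|].
    unfold Y; generalize (Rabs_pos (snd (S_ n))); lra. }
  assert (BW : forall n, Rabs (W n) * sg ^ n <= D).
  { intros n. apply Rle_trans with (2 := BS n). apply Rmult_le_compat_r; [apply pow_le; lra|].
    unfold W; generalize (Rabs_pos (fst (S_ n))); lra. }
  set (d' := Rmin d sg).
  assert (Hd' : 0 < d') by now apply Rmin_glb_lt.
  assert (Hin : forall h, Rabs h < d' -> Rabs h < d /\ Rabs h < sg).
  { intros h Hh; split; apply Rlt_le_trans with (1 := Hh); [apply Rmin_l|apply Rmin_r]. }
  assert (DY : forall h, Rabs h < d' -> is_derive (PSeries Y) h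
    (p (x0 + h) * PSeries Y h - q (x0 + h) * PSeries W h)).
  { intros h Hh. destruct (Hin h Hh) as [H1 H2].
    assert (RY := bounded_CV_radius Y sg D h BY H2). assert
      (RW := bounded_CV_radius W sg D h BW H2).
    assert (RP := bounded_CV_radius P rho K h BP' ltac:(lra)). assert
      (RQ := bounded_CV_radius Q rho K h BQ' ltac:(lra)).
    assert (Hr1 : rho <= r) by apply Rmin_l. assert (Hs1 : rho <= s) by apply Rmin_r.
    rewrite <- (is_pseries_unique _ _ _ (HP h ltac:(lra))),
      <- (is_pseries_unique _ _ _ (HQ h ltac:(lra))).
    rewrite <- !PSeries_mult, <- PSeries_minus by (auto; now apply ex_pseries_mult).
    evar_last; [now apply is_derive_PSeries|].
    apply PSeries_ext; intros n. unfold PS_derive, PS_minus, PS_plus, PS_opp, PS_mult, Y, S_.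
    rewrite ode_seq_S; unfold ode_step; cbn [fst]. fold S_.
    rewrite minus_sum.
    match goal with |- _ * (_ * (?a - ?b)) = _ => transitivity (a + - b); [|reflexivity] end.
    field; apply not_0_INR; lia. }
  assert (DW : forall h, Rabs h < d' -> is_derive (PSeries W) h
    (q (x0 + h) * PSeries Y h + p (x0 + h) * PSeries W h)).
  { intros h Hh. destruct (Hin h Hh) as [H1 H2].
    assert (RY := bounded_CV_radius Y sg D h BY H2). assert
      (RW := bounded_CV_radius W sg D h BW H2).
    assert (RP := bounded_CV_radius P rho K h BP' ltac:(lra)). assert
      (RQ := bounded_CV_radius Q rho K h BQ' ltac:(lra)).
    assert (Hr1 : rho <= r) by apply Rmin_l. assert (Hs1 : rho <= s) by apply Rmin_r.
    rewrite <- (is_pseries_unique _ _ _ (HP h ltac:(lra))),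
      <- (is_pseries_unique _ _ _ (HQ h ltac:(lra))).
    rewrite <- !PSeries_mult, <- PSeries_plus by (auto; now apply ex_pseries_mult).
    evar_last; [now apply is_derive_PSeries|].
    apply PSeries_ext; intros n. unfold PS_derive, PS_plus, PS_mult, W, S_.
    rewrite ode_seq_S; unfold ode_step; cbn [snd]. fold S_.
    rewrite plus_sum.
    match goal with |- _ * (_ * (?a + ?b)) = _ => transitivity (a + b); [|reflexivity] end.
    field; apply not_0_INR; lia. }
  set (E := fun h => (PSeries Y h - y (x0 + h)) ^ 2 + (PSeries W h - w (x0 + h)) ^ 2).
  assert (E0 : forall h, Rabs h < d' -> E h = 0).
  { apply (gronwall_zero E (fun h => p (x0 + h)) d' B Hd').
    - intros h Hh. destruct (Hin h Hh) as [H1 H2].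
      assert (Hx : Rabs (x0 + h - x0) < d) by (replace (x0 + h - x0) with h by ring; exact H1).
      assert (Dy : is_derive (fun h => y (x0 + h)) h (p (x0 + h) * y (x0 + h) - q (x0 + h) * w
        (x0 + h))).
      { evar_last; [apply (is_derive_comp (V := R_NormedModule) y (fun h => x0 + h));
          [now apply Hy|auto_derive; auto]|].
        unfold scal; simpl; unfold mult; simpl; in_reals; ring. }
      assert (Dw : is_derive (fun h => w (x0 + h)) h (q (x0 + h) * y (x0 + h) + p (x0 + h) * w
        (x0 + h))).
      { evar_last; [apply (is_derive_comp (V := R_NormedModule) w (fun h => x0 + h));
          [now apply Hw|auto_derive; auto]|].
        unfold scal; simpl; unfold mult; simpl; in_reals; ring. }
      unfold E. evar_last.
      + apply (is_derive_plus (V := R_NormedModule)); apply is_derive_pow;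
          apply (is_derive_minus (V := R_NormedModule)).
        * apply DY, Hh.
        * apply Dy.
        * apply DW, Hh.
        * apply Dw.
      + unfold minus, plus, opp; simpl; in_reals; ring.
    - intros h Hh; apply HB. replace (x0 + h - x0) with h by ring; now apply Hin.
    - intros h; unfold E; generalize (pow2_ge_0 (PSeries Y h - y (x0 + h)))
        (pow2_ge_0 (PSeries W h - w (x0 + h))); lra.
    - unfold E; rewrite !PSeries_0, Rplus_0_r; unfold Y, W, S_, ode_seq; simpl; ring. }
  assert (Z : forall h, Rabs h < d' -> PSeries Y h = y (x0 + h) /\ PSeries W h = w (x0 + h)).
  { intros h Hh. assert (Eh := E0 h Hh). unfold E in Eh.
    assert (A1 := pow2_ge_0 (PSeries Y h - y (x0 + h))). assert
      (A2 := pow2_ge_0 (PSeries W h - w (x0 + h))).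
    split; apply Rminus_diag_uniq; apply Rsqr_0_uniq; unfold Rsqr; simpl in *; lra. }
  split.
  - exists Y, d'; split; auto. intros x Hx. destruct (Hin _ Hx) as [H1 H2].
    destruct (Z _ Hx) as [Z1 _]. replace (x0 + (x - x0)) with x in Z1 by ring. rewrite <- Z1.
    apply PSeries_correct, CV_radius_inside. eapply bounded_CV_radius; eauto.
  - exists W, d'; split; auto. intros x Hx. destruct (Hin _ Hx) as [H1 H2].
    destruct (Z _ Hx) as [_ Z1]. replace (x0 + (x - x0)) with x in Z1 by ring. rewrite <- Z1.
    apply PSeries_correct, CV_radius_inside. eapply bounded_CV_radius; eauto.
Qed.

(** The Taylor series in x may be integrated term by term when the remainders have a
    common integrable majorant. *)
Lemma analytic_integral (phi : R -> R -> R) (c : nat -> R -> R) (g : R -> R) (x0 : R) :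
  (forall x, dominated (phi x)) -> (forall k, dominated (c k)) -> dominated g ->
  (forall n h t, Rabs h < 1 -> 0 <= t ->
    Rabs (phi (x0 + h) t - sum_f_R0 (fun k => h ^ k * c k t) n) <= Rabs h ^ S n * g t) ->
  real_analytic_at (fun x => improper (phi x)) x0.
Proof.
  intros Dp Dc Dg H.
  exists (fun k => improper (c k)), 1; split; [lra|]. intros x Hx.
  set (h := x - x0) in *. replace x with (x0 + h) by (unfold h; ring).
  apply (proj2 (is_pseries_R _ _ _)).
  assert (B : forall n, Rabs (sum_n (fun k => improper (c k) * h ^ k) n - improper (phi (x0 + h)))
    <= improper g * Rabs h ^ S n).
  { intros n. rewrite <- Rabs_Ropp, Ropp_minus_distr.
    assert (Df : forall k, dominated (fun t => h ^ k * c k t)) by (intros;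
      now apply dominated_scal).
    destruct (dominated_sum (fun k t => h ^ k * c k t) n Df) as [DS ES].
    rewrite sum_n_Reals, Rmult_comm, <- improper_scal by auto.
    rewrite (sum_eq _ (fun k => improper (fun t => h ^ k * c k t))).
    2: { intros k _; rewrite improper_scal by auto; ring. }
    rewrite <- ES.
    replace (improper (phi (x0 + h)) - improper _) with
      (improper (fun t => phi (x0 + h) t + -1 * sum_f_R0 (fun k => h ^ k * c k t) n)).
    2: { rewrite improper_plus, improper_scal; auto using dominated_scal; ring. }
    apply improper_abs_le; auto using dominated_plus, dominated_scal.
    intros t Ht. eapply Rle_trans; [|apply (H n h t Hx Ht)]. right; f_equal; ring. }
  assert (L : is_lim_seq (fun n => improper g * Rabs h ^ S n) 0).
  { replace (Finite 0) with (Rbar_mult (improper g) 0) by (simpl; f_equal; ring).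
    apply is_lim_seq_scal_l. apply (is_lim_seq_incr_1 (fun n => Rabs h ^ n)).
    apply is_lim_seq_geom. now rewrite Rabs_Rabsolu. }
  assert (L2 : is_lim_seq (sum_n (fun k => improper (c k) * h ^ k)) (improper (phi (x0 + h)))).
  { apply (is_lim_seq_le_le (fun n => improper (phi (x0 + h)) - improper g * Rabs h ^ S n) _
      (fun n => improper (phi (x0 + h)) + improper g * Rabs h ^ S n)).
    - intros n; specialize (B n); apply Rabs_le_between in B; lra.
    - replace (Finite (improper (phi (x0 + h)))) with (Finite (improper (phi (x0 + h)) - 0))
        by (f_equal; ring).
      apply is_lim_seq_minus'; [apply is_lim_seq_const|exact L].
    - replace (Finite (improper (phi (x0 + h)))) with (Finite (improper (phi (x0 + h)) + 0))
        by (f_equal; ring).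
      apply is_lim_seq_plus'; [apply is_lim_seq_const|exact L]. }
  exact L2.
Qed.

Lemma analytic_inv x0 : x0 <> 0 -> real_analytic_at Rinv x0.
Proof.
  intros H0. exists (fun n => / x0 * (- / x0) ^ n), (Rabs x0); split; [now apply Rabs_pos_lt|].
  intros x Hx. apply (proj2 (is_pseries_R _ _ _)).
  set (h := x - x0) in *.
  assert (Hq : Rabs (- (h / x0)) < 1).
  { rewrite Rabs_Ropp; unfold Rdiv; rewrite Rabs_mult, Rabs_inv. apply Rlt_div_l;
      [now apply Rabs_pos_lt|lra]. }
  assert (Hx0 : x <> 0).
  { intros ->. unfold h in Hx; rewrite Rminus_0_l, Rabs_Ropp in Hx; lra. }
  assert (H := is_series_scal_l (/ x0) _ _ (is_series_geom _ Hq)).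
  replace (/ x) with (scal (/ x0) (/ (1 - - (h / x0)))).
  - apply (is_series_ext (V := R_NormedModule)) with (2 := H). intros n.
    unfold scal; simpl; unfold mult; simpl.
    rewrite Rmult_assoc, <- Rpow_mult_distr; do 2 f_equal; field; auto.
  - unfold scal; simpl; unfold mult; simpl; in_reals. unfold h; field. split; auto.
Qed.

(** * Analyticity of the contour integral and of the phase *)

Section AnalyticContour.

Variable eps : R.
Hypothesis Heps : 0 < eps.

(** Here |t h|^n / n! is at most |h|^n exp t, and the Gaussian weight absorbs exp t.
    The weight is taken at x = 0, the modulus of the integrand depending on x only
    through the constant factor exp(- eps x). *)
Lemma analytic_line_integral ph x0 :
  real_analytic_at (fun x => improper (fun t => exp (log_modulus 0 t eps) * cos
    (ph + argument x t eps))) x0.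
Proof.
  apply (analytic_integral _
    (fun k t => exp (log_modulus 0 t eps) * (t ^ k / INR (fact k) * cos
      (ph + argument x0 t eps + INR k * (PI / 2))))
    (fun t => exp (log_modulus 0 t eps + t))).
  - intros x; apply dominated_line; auto; [unfold argument; smooth|intros; apply Rabs_cos_le].
  - intros k. assert (F := INR_fact_lt_0 k).
    apply dominated_le with (fun t => / INR (fact k) * (t ^ k * exp (log_modulus 0 t eps))).
    + unfold log_modulus, argument; smooth.
    + now apply dominated_scal, dominated_exp_line.
    + intros t Ht; rewrite !Rabs_mult, (Rabs_pos_eq (exp _)) by (left; apply exp_pos).
      unfold Rdiv; rewrite Rabs_mult, (Rabs_pos_eq (t ^ k)), (Rabs_pos_eq (/ _)).
      * assert (C := Rabs_cos_le (ph + argument x0 t eps + INR k * (PI * / 2))).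
        replace (/ INR (fact k) * (t ^ k * exp (log_modulus 0 t eps))) with
          (exp (log_modulus 0 t eps) * (t ^ k * / INR (fact k) * 1)) by ring.
        apply Rmult_le_compat_l; [left; apply exp_pos|]. apply Rmult_le_compat_l; [|exact C].
        apply Rmult_le_pos; [now apply pow_le|left; now apply Rinv_0_lt_compat].
      * left; now apply Rinv_0_lt_compat.
      * now apply pow_le.
  - assert (He2 : 0 < eps / 2) by lra.
    apply dominated_le with (fun t => exp (eps ^ 3 / 3 + / (2 * eps)) *
      (t ^ 0 * exp (- (eps / 2) * t ^ 2))).
    + unfold log_modulus; smooth.
    + now apply dominated_scal, dominated_gauss.
    + intros t Ht; rewrite Rabs_pos_eq by (left; apply exp_pos).
      simpl (t ^ 0); rewrite Rmult_1_l, <- exp_plus. apply exp_le. unfold log_modulus.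
      (* Half of the Gaussian absorbs exp t, by completing the square. *)
      assert (0 <= / (2 * eps) * (eps * t - 1) ^ 2).
      { apply Rmult_le_pos; [left; apply Rinv_0_lt_compat; lra|apply pow2_ge_0]. }
      replace (/ (2 * eps) * (eps * t - 1) ^ 2) with (eps / 2 * t ^ 2 - t + / (2 * eps)) in H
        by (field; lra).
      lra.
  - intros n h t Hh Ht.
    assert (B := cos_taylor_bound (ph + argument x0 t eps) (h * t) n).
    replace (ph + argument (x0 + h) t eps) with (ph + argument x0 t eps + h * t)
      by (unfold argument; ring).
    replace (exp (log_modulus 0 t eps) * _ - _) with (exp (log_modulus 0 t eps) *
      (cos (ph + argument x0 t eps + h * t) -
       sum_f_R0 (fun k => (h * t) ^ k / INR (fact k) * cos
         (ph + argument x0 t eps + INR k * (PI / 2))) n)).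
    + rewrite Rabs_mult, (Rabs_pos_eq (exp _)) by (left; apply exp_pos). rewrite exp_plus.
      replace (Rabs h ^ S n * (exp (log_modulus 0 t eps) * exp t)) with
        (exp (log_modulus 0 t eps) * (Rabs h ^ S n * exp t)) by ring.
      apply Rmult_le_compat_l; [left; apply exp_pos|]. apply Rle_trans with (1 := B).
      rewrite Rabs_mult, (Rabs_pos_eq t) by auto. rewrite Rpow_mult_distr. unfold Rdiv;
        rewrite Rmult_assoc.
      apply Rmult_le_compat_l; [apply pow_le, Rabs_pos|]. now apply pow_div_fact_le_exp.
    + rewrite Rmult_minus_distr_l, scal_sum. f_equal. apply sum_eq; intros k _.
      rewrite Rpow_mult_distr; unfold Rdiv; ring.
Qed.

(** The cubic in the exponent absorbs the factor exp(2 y) of the remainder. *)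
Lemma analytic_vertical_integral x0 :
  real_analytic_at (fun x => improper (fun y => exp (log_modulus 0 0 (eps - y) + x * y))) x0.
Proof.
  assert (D : forall x, dominated (fun y => exp (log_modulus 0 0 (eps - y) + x * y))).
  { intros x. apply dominated_le with (fun y => exp (x * eps) * exp (log_modulus x 0 (eps - y))).
    - unfold log_modulus; smooth.
    - now apply dominated_scal, dominated_exp_vertical.
    - intros y _; rewrite Rabs_pos_eq by (left; apply exp_pos). rewrite <- exp_plus.
      right; f_equal; unfold log_modulus; field. }
  apply (analytic_integral _
    (fun k y => exp (log_modulus 0 0 (eps - y) + x0 * y) * (y ^ k / INR (fact k)))
    (fun y => exp (log_modulus 0 0 (eps - y) + (x0 + 2) * y))); auto.
  - intros k. assert (F := INR_fact_lt_0 k).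
    apply dominated_le with (fun y => exp (log_modulus 0 0 (eps - y) + (x0 + 1) * y)); auto.
    + unfold log_modulus; smooth.
    + intros t Ht. assert (T : 0 <= t ^ k / INR (fact k)).
      { apply Rmult_le_pos; [now apply pow_le|left; now apply Rinv_0_lt_compat]. }
      rewrite Rabs_pos_eq by (apply Rmult_le_pos; [left; apply exp_pos|exact T]).
      replace (log_modulus 0 0 (eps - t) + (x0 + 1) * t) with
        ((log_modulus 0 0 (eps - t) + x0 * t) + t) by ring.
      rewrite (exp_plus _ t). apply Rmult_le_compat_l; [left;
        apply exp_pos|]. now apply pow_div_fact_le_exp.
  - intros n h t Hh Ht.
    assert (B := exp_taylor_bound (h * t) n).
    replace (log_modulus 0 0 (eps - t) + (x0 + h) * t) with
      ((log_modulus 0 0 (eps - t) + x0 * t) + h * t) by ring.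
    rewrite (exp_plus _ (h * t)). set (e := exp (log_modulus 0 0 (eps - t) + x0 * t)).
    replace (e * exp (h * t) - _) with (e * (exp (h * t) - sum_f_R0
      (fun k => (h * t) ^ k / INR (fact k)) n)).
    + rewrite Rabs_mult, (Rabs_pos_eq e) by (left; apply exp_pos).
      replace (log_modulus 0 0 (eps - t) + (x0 + 2) * t) with
        ((log_modulus 0 0 (eps - t) + x0 * t) + (t + t)) by ring.
      rewrite (exp_plus _ (t + t)), (exp_plus t t). fold e.
      replace (Rabs h ^ S n * (e * (exp t * exp t))) with (e * (Rabs h ^ S n * exp t * exp t))
        by ring.
      apply Rmult_le_compat_l; [left; apply exp_pos|]. apply Rle_trans with (1 := B).
      rewrite Rabs_mult, (Rabs_pos_eq t) by auto.
      assert (F := INR_fact_lt_0 (S n)). assert (P := pow_le (Rabs h) (S n) (Rabs_pos h)).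
      apply Rmult_le_compat.
      * apply Rmult_le_pos; [apply pow_le, Rmult_le_pos; auto using Rabs_pos|left;
          now apply Rinv_0_lt_compat].
      * left; apply exp_pos.
      * rewrite Rpow_mult_distr. unfold Rdiv; rewrite Rmult_assoc.
        apply Rmult_le_compat_l; [exact P|]. now apply pow_div_fact_le_exp.
      * apply exp_le. nra.
    + rewrite Rmult_minus_distr_l, scal_sum. f_equal. apply sum_eq; intros k _.
      rewrite Rpow_mult_distr; unfold Rdiv; ring.
Qed.

Lemma analytic_exp_linear x0 : real_analytic_at (fun x => exp (- eps * x)) x0.
Proof.
  apply (analytic_linear_ode (fun x => exp (- eps * x)) (fun _ => 0) (fun _ => - eps) (fun _ => 0)
    x0 1 (Rabs eps)).
  - lra.
  - apply analytic_const.
  - apply analytic_const.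
  - intros x _; auto_derive; auto; ring.
  - intros x _; auto_derive; auto; ring.
  - intros x _; rewrite Rabs_Ropp; lra.
Qed.

Lemma contour_re_factor x : contour_re eps x =
  exp (- eps * x) * improper (fun t => exp (log_modulus 0 t eps) * cos (0 + argument x t eps)).
Proof.
  assert (D : dominated (fun t => exp (log_modulus 0 t eps) * cos (0 + argument x t eps))).
  { apply dominated_line; auto; [unfold argument; smooth|intros; apply Rabs_cos_le]. }
  rewrite <- improper_scal by auto. symmetry; apply improper_ext; [|now apply dominated_scal].
  intros t _. rewrite <- Rmult_assoc, <- exp_plus, Rplus_0_l. f_equal; f_equal;
    unfold log_modulus; field.
Qed.

Lemma contour_im_factor x : contour_im eps x =
  exp (- eps * x) * (improper (fun t => exp (log_modulus 0 t eps) * cos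
    (- (PI / 2) + argument x t eps)) +
    improper (fun y => exp (log_modulus 0 0 (eps - y) + x * y))).
Proof.
  assert (D : dominated (fun t => exp (log_modulus 0 t eps) * cos (- (PI / 2) + argument x t eps))).
  { apply dominated_line; auto; [unfold argument; smooth|intros; apply Rabs_cos_le]. }
  unfold contour_im. rewrite Rmult_plus_distr_l. rewrite <- improper_scal by auto.
  f_equal.
  - symmetry; apply improper_ext; [|now apply dominated_scal].
    intros t _. rewrite <- Rmult_assoc, <- exp_plus.
    replace (- (PI / 2) + argument x t eps) with (- (PI / 2 - argument x t eps)) by ring.
    rewrite cos_neg, cos_shift. f_equal; f_equal; unfold log_modulus; field.
  - assert (E : forall y, exp (log_modulus 0 0 (eps - y) + x * y) = exp (eps * x) * exp
      (log_modulus x 0 (eps - y))).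
    { intros y; rewrite <- exp_plus; f_equal; unfold log_modulus; field. }
    rewrite <- (improper_ext (fun y => exp (eps * x) * exp (log_modulus x 0 (eps - y)))
      (fun y => exp (log_modulus 0 0 (eps - y) + x * y))); auto.
    + rewrite improper_scal by now apply dominated_exp_vertical.
      rewrite <- Rmult_assoc, <- exp_plus. replace (- eps * x + eps * x) with 0 by ring. rewrite
        exp_0; ring.
    + now apply dominated_scal, dominated_exp_vertical.
Qed.

Lemma analytic_contour x0 : real_analytic_at (contour_re eps) x0 /\ real_analytic_at
  (contour_im eps) x0.
Proof.
  split.
  - apply (analytic_ext_loc _ _ x0 1 Rlt_0_1 (fun x _ => eq_sym (contour_re_factor x))).
    apply analytic_mult; [apply analytic_exp_linear|apply analytic_line_integral].
  - apply (analytic_ext_loc _ _ x0 1 Rlt_0_1 (fun x _ => eq_sym (contour_im_factor x))).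
    apply analytic_mult; [apply analytic_exp_linear|].
    apply analytic_plus; [apply analytic_line_integral|apply analytic_vertical_integral].
Qed.

End AnalyticContour.

(** PI/4 - (2/3)(-x)^(3/2), in a form that avoids real powers. *)
Definition airy_phase (x : R) : R := PI / 4 - 2 / 3 * (- x * sqrt (- x)).

Lemma derive_airy_phase x : x < 0 -> is_derive airy_phase x (sqrt (- x)).
Proof.
  intros Hx; unfold airy_phase; auto_derive; [lra|].
  assert (E := sqrt_sqrt (- x) ltac:(lra)). assert (P : 0 < sqrt (- x)) by (apply sqrt_lt_R0; lra).
  set (r := sqrt (- x)) in *. rewrite <- E; field; lra.
Qed.

(** Here y' = y / (2 x). *)
Lemma analytic_sqrt_opp x0 : x0 < 0 -> real_analytic_at (fun x => sqrt (- x)) x0.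
Proof.
  intros H0.
  apply (analytic_linear_ode (fun x => sqrt (- x)) (fun _ => 0) (fun x => / 2 * / x) (fun _ => 0)
    x0 (- x0 / 2) (/ - x0)).
  - lra.
  - apply analytic_scal, analytic_inv; lra.
  - apply analytic_const.
  - intros x Hx. apply Rabs_lt_between in Hx. assert (x < 0) by lra.
    auto_derive; [lra|].
    assert (S := sqrt_sqrt (- x) ltac:(lra)). assert (P : 0 < sqrt (- x)) by (apply sqrt_lt_R0;
      lra).
    replace (/ x) with (- / (sqrt (- x) * sqrt (- x))) by (rewrite S; field; lra). field; lra.
  - intros x _; auto_derive; auto; ring.
  - intros x Hx. apply Rabs_lt_between in Hx. assert (x < 0) by lra.
    rewrite Rabs_mult, Rabs_inv, Rabs_inv, (Rabs_pos_eq 2), (Rabs_left x) by lra.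
    rewrite <- Rinv_mult. apply Rinv_le_contravar; lra.
Qed.

(** With theta' = sqrt(-x), the pair (cos theta, sin theta) solves y' = - theta' w,
    w' = theta' y. *)
Lemma analytic_cos_sin_phase x0 : x0 < 0 ->
  real_analytic_at (fun x => cos (airy_phase x)) x0 /\ real_analytic_at
    (fun x => sin (airy_phase x)) x0.
Proof.
  intros H0.
  apply (analytic_linear_ode _ _ (fun _ => 0) (fun x => sqrt (- x)) x0 (- x0) 0).
  - lra.
  - apply analytic_const.
  - now apply analytic_sqrt_opp.
  - intros x Hx. apply Rabs_lt_between in Hx.
    evar_last; [apply (is_derive_comp (V := R_NormedModule) cos airy_phase);
      [apply is_derive_cos|apply derive_airy_phase; lra]|].
    unfold scal; simpl; unfold mult; simpl; in_reals; ring.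
  - intros x Hx. apply Rabs_lt_between in Hx.
    evar_last; [apply (is_derive_comp (V := R_NormedModule) sin airy_phase);
      [apply is_derive_sin|apply derive_airy_phase; lra]|].
    unfold scal; simpl; unfold mult; simpl; in_reals; ring.
  - intros; rewrite Rabs_R0; lra.
Qed.

(** * The decomposition of the Airy function *)

(** With amplitude_im, the real and imaginary parts A and B of e^(-i theta) F, F being the
    contour integral and theta the phase. *)
Definition amplitude_re (eps x : R) : R := cos (airy_phase x) * contour_re eps x + sin
  (airy_phase x) * contour_im eps x.

Definition amplitude_im (eps x : R) : R := cos (airy_phase x) * contour_im eps x + - 1 *
  (sin (airy_phase x) * contour_re eps x).

Lemma airy_phase_pow v : 0 < v -> airy_phase (- v ^ 4) = PI / 4 - 2 / 3 * v ^ 6.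
Proof.
  intros Hv; unfold airy_phase. rewrite Ropp_involutive.
  replace (sqrt (v ^ 4)) with (v ^ 2).
  - ring.
  - replace (v ^ 4) with (v ^ 2 * v ^ 2) by ring. rewrite sqrt_square; auto. apply pow2_ge_0.
Qed.

(** The rotation by - theta cancels the value - (2/3) v^6 of the exponent at the saddle
    point and leaves the phase PI/3 - PI/4 = PI/12. *)
Lemma amplitude_saddle eps v : 0 < eps -> 0 < v ->
  amplitude_re eps (- v ^ 4) = 2 / v * saddle_integral (PI / 12) v /\
  amplitude_im eps (- v ^ 4) = 2 / v * saddle_integral (PI / 12 - PI / 2) v.
Proof.
  intros He Hv. destruct (contour_shift eps v He Hv) as [H1 H2].
  unfold amplitude_re, amplitude_im. rewrite airy_phase_pow by auto.
  set (z := 2 / 3 * v ^ 6) in *. set (th := PI / 4 - z).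
  assert (ck : forall phi r, continuous (fun r => 2 / v * saddle_kernel phi v r) r).
  { unfold saddle_kernel; smooth. }
  assert (Q : forall phi, is_improper (fun r => 2 / v * saddle_kernel phi v r)
    (2 / v * saddle_integral phi v)).
  { intros phi; apply is_improper_scal; [apply dominated_saddle|apply improper_correct,
      dominated_saddle]. }
  assert (S : forall a r, cos (a - PI / 2 - r) = sin (a - r)).
  { intros a r; replace (a - PI / 2 - r) with (- (PI / 2 - (a - r))) by ring. now rewrite cos_neg,
      cos_shift. }
  split.
  - apply (is_improper_unique (fun r => cos th * (2 / v * saddle_kernel (PI / 3 - z) v r) +
       sin th * (2 / v * saddle_kernel (PI / 3 - z - PI / 2) v r))).
    + apply (is_improper_plus (fun r => cos th * (2 / v * saddle_kernel (PI / 3 - z) v r))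
        (fun r => sin th * (2 / v * saddle_kernel (PI / 3 - z - PI / 2) v r))).
      * intros t; apply (continuous_scal_r (V := R_NormedModule)), ck.
      * intros t; apply (continuous_scal_r (V := R_NormedModule)), ck.
      * apply is_improper_scal; [apply ck|exact H1].
      * apply is_improper_scal; [apply ck|exact H2].
    + apply is_improper_ext with (2 := Q (PI / 12)). intros r _; unfold saddle_kernel.
      rewrite S. replace (PI / 12 - r ^ 2 / 2) with ((PI / 3 - z - r ^ 2 / 2) - th) by (unfold th;
        field).
      rewrite cos_minus; ring.
  - apply (is_improper_unique (fun r => cos th * (2 / v * saddle_kernel (PI / 3 - z - PI / 2) v r) +
       -1 * (sin th * (2 / v * saddle_kernel (PI / 3 - z) v r)))).
    + assert (c1 : forall t, continuous (fun r => sin th *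
        (2 / v * saddle_kernel (PI / 3 - z) v r)) t).
      { intros t; apply (continuous_scal_r (V := R_NormedModule)), ck. }
      apply (is_improper_plus (fun r => cos th * (2 / v * saddle_kernel (PI / 3 - z - PI / 2) v r))
        (fun r => -1 * (sin th * (2 / v * saddle_kernel (PI / 3 - z) v r)))).
      * intros t; apply (continuous_scal_r (V := R_NormedModule)), ck.
      * intros t; apply (continuous_scal_r (V := R_NormedModule)), c1.
      * apply is_improper_scal; [apply ck|exact H2].
      * apply is_improper_scal; [exact c1|]. apply is_improper_scal; [apply ck|exact H1].
    + apply is_improper_ext with (2 := Q (PI / 12 - PI / 2)). intros r _; unfold saddle_kernel.
      rewrite !S. replace (PI / 12 - r ^ 2 / 2) with ((PI / 3 - z - r ^ 2 / 2) - th)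
        by (unfold th; field).
      rewrite sin_minus; ring.
Qed.

(** The constants agree because 4 sqrt PI / (2 PI^(3/2)) = 2 / PI. *)
Lemma scaled_saddle_amplitude phi u : 0 < u ->
  / PI * (2 / Rpower u (/ 6) * saddle_integral phi (Rpower u (/ 6))) = prefactor u * scaled_saddle
    phi u.
Proof.
  intros Hu. unfold prefactor, scaled_saddle.
  assert (P := PI_RGT_0). assert (SP : 0 < sqrt PI) by now apply sqrt_lt_R0.
  assert (V : 0 < Rpower u (/ 6)) by apply exp_pos.
  replace (3 / 2) with (1 + / 2) by field. rewrite Rpower_plus, Rpower_1, Rpower_sqrt by auto.
  rewrite Rpower_Ropp. replace (1 / 6) with (/ 6) by field. field. lra.
Qed.

Theorem proposition7p3 (eps : R) (Heps : 0 < eps) :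
  exists Ai0 Ai1 : R -> R,
    (forall x : R, x < 0 -> Airy eps x = RtoC (Ai0 x + Ai1 x)) /\
    (forall x : R, x < 0 -> real_analytic_at Ai0 x) /\
    (forall x : R, x < 0 -> real_analytic_at Ai1 x) /\
    strong_asymptotic_expansion (fun u : R => Ai0 (- Rpower u (2 / 3))) Ai0_term /\
    strong_asymptotic_expansion (fun u : R => Ai1 (- Rpower u (2 / 3))) Ai1_term.
Proof.
  exists (fun x => / PI * (cos (airy_phase x) * amplitude_re eps x)),
         (fun x => - / PI * (sin (airy_phase x) * amplitude_im eps x)).
  assert (P := PI_RGT_0).
  assert (U : forall u, 0 < u -> Rpower u (2 / 3) = Rpower u (/ 6) ^ 4).
  { intros u Hu. rewrite <- Rpower_pow by apply exp_pos. rewrite Rpower_mult; f_equal; simpl;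
      field. }
  split; [|split; [|split; [|split]]].
  - intros x Hx. rewrite Airy_value by auto. f_equal.
    unfold amplitude_re, amplitude_im. assert (C := sin2_cos2 (airy_phase x)). unfold Rsqr in C.
    replace (contour_re eps x / PI) with (/ PI * ((sin (airy_phase x) * sin (airy_phase x) + cos
      (airy_phase x) * cos (airy_phase x)) * contour_re eps x)).
    + ring.
    + rewrite C; field; lra.
  - intros x Hx. destruct (analytic_contour eps Heps x) as [A B]. destruct
      (analytic_cos_sin_phase x Hx) as [C S].
    apply analytic_scal, analytic_mult; auto.
    apply analytic_plus; apply analytic_mult; auto.
  - intros x Hx. destruct (analytic_contour eps Heps x) as [A B]. destruct
      (analytic_cos_sin_phase x Hx) as [C S].
    apply analytic_scal, analytic_mult; auto.
    apply analytic_plus; [now apply analytic_mult|]. apply analytic_scal, analytic_mult; auto.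
  - apply even_expansion. intros u Hu. rewrite U by auto.
    assert (V : 0 < Rpower u (/ 6)) by apply exp_pos.
    destruct (amplitude_saddle eps _ Heps V) as [H _]. rewrite H, airy_phase_pow, sixth_root_pow
      by auto.
    rewrite (Rmult_comm (prefactor u)), Rmult_assoc, <- scaled_saddle_amplitude by auto. ring.
  - apply odd_expansion. intros u Hu. rewrite U by auto.
    assert (V : 0 < Rpower u (/ 6)) by apply exp_pos.
    destruct (amplitude_saddle eps _ Heps V) as [_ H]. rewrite H, airy_phase_pow, sixth_root_pow
      by auto.
    transitivity (- (sin (PI / 4 - 2 / 3 * u) * (prefactor u * scaled_saddle (PI / 12 - PI / 2)
      u))); [|ring].
    rewrite <- scaled_saddle_amplitude by auto. ring.
Qed.
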